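(* Let $V$ be a finite dimensional graded vector space. Any $L_\infty$-bialgebra structure on $V$ is given by an operator $Q=\sum_{k,m\ge 1}Q_{km}$ of total degree $1$ on the formal manifold corresponding to $V[1]$, where $Q_{km}$ is of polynomial degree $k$ in the coordinates $x^\alpha$ and of polynomial degree $m$ in the $\xi_\alpha=\partial/\partial x^\alpha$, and corresponds to the component $t_{km}\in\bigwedge^kV^*\otimes\bigwedge^mV$ of the structure. The Poisson bracket of this operator with itself is zero: $\{Q,Q\}=0$.
   Context: The ground field $\mathbb K$ is $\mathbb R$ or $\mathbb C$. $V=\bigoplus_aV^a$ is finite dimensional and $\mathbb Z$-graded; $V^*$ is graded so that the dual of $V^a$ has degree $-a$. The degree of a homogeneous $x$ is $\widetilde x$. Total degree. A product $w=x_1^*\cdots x_p^*\,y^1\cdots y^q\in\bigwedge^pV^*\otimes\bigwedge^qV$ of homogeneous elements has total degree $|w|=\sum\widetilde{x_i^*}+\sum\widetilde{y^j}+(p+q-2)$; in particular $|v|=\widetilde v-1$ for $v\in V\oplus V^*$. The Koszul sign rule is used with respect to total degree, so $v\wedge w=(-1)^{|v||w|}w\wedge v$ for $v,w\in V\oplus V^*$. Big bracket. On $B=\bigoplus_{p,q\ge0}\bigwedge^pV^*\otimes\bigwedge^qV$ (formal infinite sums are allowed) the big bracket $[\cdot,\cdot]$ is the graded Lie bracket of total degree $0$ such that: scalars are central; for $u,v\in V\oplus V^*$, $[u,v]=\langle u,v\rangle$, the graded symmetric form extending the natural pairing of $V$ and $V^*$, with $V$ and $V^*$ isotropic; $[u,v]=-(-1)^{|u||v|}[v,u]$;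 and $[u,v\wedge w]=[u,v]\wedge w+(-1)^{|u||v|}v\wedge[u,w]$. $L_\infty$-bialgebra. An $L_\infty$-bialgebra structure on $V$ is an element $T=\sum_{k\ge1,\,l\ge1}t_{kl}$, $t_{kl}\in\bigwedge^kV^*\otimes\bigwedge^lV$, with every $t_{kl}$ of total degree $1$, such that $[T,T]=0$; equivalently, it is the corresponding family of maps $\tau_{kl}:\bigwedge^kV\to\bigwedge^lV[3-(k+l)]$, $\tau_{kl}(v_1\wedge\cdots\wedge v_k)=[[\cdots[[t_{kl},v_1],v_2]\cdots],v_k]$. Formal manifold and operators. Let $\{e_\alpha\}$ be a homogeneous basis of $V$ and $\{x^\alpha\}$ the dual coordinates, viewed as elements of $V^*[-1]$; functions on the formal manifold corresponding to $V[1]$ are (formal power series) elements of $Sym(V^*[-1])$. Put $\xi_\alpha=\partial/\partial x^\alpha\in V[1]$. The ring of (symbols of) differential operators on $V[1]$ is $Sym(V^*[-1])[\xi_1,\dots,\xi_n]$, $n=\dim V$, formal infinite sums being allowed. A component $Q_{km}$, of degree $k$ in the $x$'s and $m$ in the $\xi$'s, acts as $Sym^m(V^*[-1])\to Sym^k(V^*[-1])$; by the identification $Sym^n(X[1])\simeq(\bigwedge^nX)[n]$ it corresponds to an element of $\bigwedge^kV^*\otimes\bigwedge^mV$ and, dually, to a map $\bigwedge^kV\to\bigwedge^mV$. Its total degree is the total degree of the corresponding element, i.e. the internal degree plus $k+m-2$. On this ring one uses the canonical graded Poisson bracket $$\{E,F\}=\frac{\partial E}{\partial x^\alpha}\frac{\partial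 F}{\partial\xi_\alpha}-(-1)^{\widetilde E\widetilde F}\frac{\partial F}{\partial x^\alpha}\frac{\partial E}{\partial\xi_\alpha}$$ (summation over $\alpha$; signs and left/right derivatives according to the Koszul convention, so that it is a graded Lie bracket and a biderivation). *)

(* Defs.v *)
From HB Require Import structures.
From mathcomp Require Import all_boot all_algebra.
From mathcomp Require Import boolp reals.
From mathcomp.real_closed Require Import complex.

Set Implicit Arguments.
Unset Strict Implicit.
Unset Printing Implicit Defensive.

Import GRing.Theory Num.Theory.
Local Open Scope ring_scope.
Local Open Scope quotient_scope.

Variant scalars := RealScalars | ComplexScalars.

Definition ground (R : realType) (c : scalars) : fieldType :=
  match c with RealScalars => R | ComplexScalars => R[i] end.

(* The Koszul sign (-1)^(d1 d2). *)
Definition ksign (K : fieldType) (d1 d2 : int) : K :=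
  (-1) ^+ (odd `|d1|%N && odd `|d2|%N).

Section GradedSpace.
Variables (K : fieldType) (V : vectType K) (gr : int -> {vspace V}).

Definition is_grading : Prop :=
  exists s : seq int,
    [/\ uniq s,
        (forall d, d \notin s -> gr d = 0%VS),
        (\sum_(d <- s) gr d)%VS = fullv
      & directv (\sum_(d <- s) gr d)].

Definition dual_space : vectType K := 'Hom(V, K^o).

(* The dual of V^d is the space of forms vanishing on all other V^b, and it
   has degree -d. *)
Definition dual_homog (d : int) (f : dual_space) : Prop :=
  forall b v, b != - d -> v \in gr b -> f v = 0.

(* V^* (+) V *)
Definition double : vectType K := (dual_space * V)%type.

Definition in_dual (f : dual_space) : double := (f, 0).
Definition in_vect (v : V) : double := (0, v).

Definition double_homog (d : int) (u : double) : Prop :=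
  dual_homog d u.1 /\ u.2 \in gr d.

(* The graded symmetric form with <f, v> = f v and V, V^* isotropic, on
   homogeneous u, v of degrees du, dv; graded symmetry forces
   <v, f> = (-1)^(dv df) f v. *)
Definition pairing (du dv : int) (u v : double) : K :=
  u.1 v.2 + ksign K du dv * v.1 u.2.

(* The algebra (+)_{p,q} /\^p V^* (x) /\^q V: the free unital associative
   algebra on the vector space V^* (+) V modulo
   u /\ v = (-1)^(|u||v|) v /\ u, with |u| = (degree of u) - 1.  It is built
   as syntactic expressions modulo the congruence generated by the algebra
   axioms, linearity of the inclusion of V^* (+) V, and these relations. *)
Inductive expr :=
  | EGen of double
  | EScal of K
  | EAdd of expr & expr
  | EMul of expr & expr.

Inductive econg : expr -> expr -> Prop :=
  | econg_refl s : econg s s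
  | econg_sym s t : econg s t -> econg t s
  | econg_trans s t r : econg s t -> econg t r -> econg s r
  | econg_add s s' t t' :
      econg s s' -> econg t t' -> econg (EAdd s t) (EAdd s' t')
  | econg_mul s s' t t' :
      econg s s' -> econg t t' -> econg (EMul s t) (EMul s' t')
  | econg_addA s t r : econg (EAdd s (EAdd t r)) (EAdd (EAdd s t) r)
  | econg_addC s t : econg (EAdd s t) (EAdd t s)
  | econg_add0 s : econg (EAdd (EScal 0) s) s
  | econg_mulA s t r : econg (EMul s (EMul t r)) (EMul (EMul s t) r)
  | econg_mul0 s : econg (EMul (EScal 0) s) (EScal 0)
  | econg_mul1l s : econg (EMul (EScal 1) s) s
  | econg_mulDl s t r : econg (EMul (EAdd s t) r) (EAdd (EMul s r) (EMul t r))
  | econg_mulDr s t r : econg (EMul r (EAdd s t)) (EAdd (EMul r s) (EMul r t))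
  | econg_scalD a b : econg (EScal (a + b)) (EAdd (EScal a) (EScal b))
  | econg_scalM a b : econg (EScal (a * b)) (EMul (EScal a) (EScal b))
  | econg_scalC a s : econg (EMul (EScal a) s) (EMul s (EScal a))
  | econg_genD u v : econg (EGen (u + v)) (EAdd (EGen u) (EGen v))
  | econg_genZ a u : econg (EGen (a *: u)) (EMul (EScal a) (EGen u))
  | econg_koszul du dv u v :
      double_homog du u -> double_homog dv v ->
      econg (EMul (EGen u) (EGen v))
            (EMul (EScal (ksign K (du - 1) (dv - 1))) (EMul (EGen v) (EGen u))).

HB.instance Definition _ := gen_eqMixin expr.
HB.instance Definition _ := gen_choiceMixin expr.

Definition econgb (s t : expr) : bool := `[< econg s t >].

Lemma econgb_refl : reflexive econgb.
Proof. by move=> s; apply/asboolP; exact: econg_refl. Qed.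

Lemma econgb_sym : symmetric econgb.
Proof.
by move=> s t; apply/idP/idP => /asboolP h; apply/asboolP; exact: econg_sym.
Qed.

Lemma econgb_trans : transitive econgb.
Proof.
move=> t s r /asboolP h1 /asboolP h2; apply/asboolP.
exact: econg_trans h1 h2.
Qed.

Canonical econg_equiv := EquivRel econgb econgb_refl econgb_sym econgb_trans.

Definition walg := {eq_quot econg_equiv}.

HB.instance Definition _ := Choice.on walg.

Definition wcls (s : expr) : walg := \pi_walg s.

Lemma wclsP s t : wcls s = wcls t <-> econg s t.
Proof.
split=> [/eqmodP/asboolP //|h].
by apply/eqmodP/asboolP.
Qed.

Lemma wclsK (x : walg) : wcls (repr x) = x.
Proof. exact: reprK. Qed.

Lemma econg_repr s : econg (repr (wcls s)) s.
Proof. by apply/wclsP; rewrite wclsK. Qed.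

Definition wadd (x y : walg) : walg := wcls (EAdd (repr x) (repr y)).
Definition wmul (x y : walg) : walg := wcls (EMul (repr x) (repr y)).
Definition wopp (x : walg) : walg := wmul (wcls (EScal (-1))) x.
Definition wscale (a : K) (x : walg) : walg := wmul (wcls (EScal a)) x.

Lemma waddE s t : wadd (wcls s) (wcls t) = wcls (EAdd s t).
Proof. by apply/wclsP/econg_add; exact: econg_repr. Qed.

Lemma wmulE s t : wmul (wcls s) (wcls t) = wcls (EMul s t).
Proof. by apply/wclsP/econg_mul; exact: econg_repr. Qed.

Lemma waddA : associative wadd.
Proof.
move=> x y z; rewrite -[x]wclsK -[y]wclsK -[z]wclsK !waddE.
by apply/wclsP; exact: econg_addA.
Qed.

Lemma waddC : commutative wadd.
Proof.
move=> x y; rewrite -[x]wclsK -[y]wclsK !waddE.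
by apply/wclsP; exact: econg_addC.
Qed.

Lemma wadd0 : left_id (wcls (EScal 0)) wadd.
Proof.
by move=> x; rewrite -[x]wclsK waddE; apply/wclsP; exact: econg_add0.
Qed.

Lemma wmulA : associative wmul.
Proof.
move=> x y z; rewrite -[x]wclsK -[y]wclsK -[z]wclsK !wmulE.
by apply/wclsP; exact: econg_mulA.
Qed.

Lemma wmul1l : left_id (wcls (EScal 1)) wmul.
Proof.
by move=> x; rewrite -[x]wclsK wmulE; apply/wclsP; exact: econg_mul1l.
Qed.

Lemma wmul_scalC a x : wmul (wcls (EScal a)) x = wmul x (wcls (EScal a)).
Proof. by rewrite -[x]wclsK !wmulE; apply/wclsP; exact: econg_scalC. Qed.

Lemma wmul1r : right_id (wcls (EScal 1)) wmul.
Proof. by move=> x; rewrite -wmul_scalC wmul1l. Qed.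

Lemma wmulDl : left_distributive wmul wadd.
Proof.
move=> x y z; rewrite -[x]wclsK -[y]wclsK -[z]wclsK !(waddE, wmulE).
by apply/wclsP; exact: econg_mulDl.
Qed.

Lemma wmulDr : right_distributive wmul wadd.
Proof.
move=> x y z; rewrite -[x]wclsK -[y]wclsK -[z]wclsK !(waddE, wmulE).
by apply/wclsP; exact: econg_mulDr.
Qed.

Lemma wscalD a b :
  wcls (EScal (a + b)) = wadd (wcls (EScal a)) (wcls (EScal b)).
Proof. by rewrite waddE; apply/wclsP; exact: econg_scalD. Qed.

Lemma wscalM a b :
  wcls (EScal (a * b)) = wmul (wcls (EScal a)) (wcls (EScal b)).
Proof. by rewrite wmulE; apply/wclsP; exact: econg_scalM. Qed.

(* The augmentation, used only to see that 1 != 0. *)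
Fixpoint eaug (s : expr) : K :=
  match s with
  | EGen _ => 0
  | EScal a => a
  | EAdd s t => eaug s + eaug t
  | EMul s t => eaug s * eaug t
  end.

Lemma eaug_econg s t : econg s t -> eaug s = eaug t.
Proof.
elim=> //= {s t}; rewrite ?(mul0r, mulr0, addr0) //.
- by move=> s t r _ -> _ ->.
- by move=> s s' t t' _ -> _ ->.
- by move=> s s' t t' _ -> _ ->.
- by move=> *; rewrite addrA.
- by move=> *; rewrite addrC.
- by move=> *; rewrite add0r.
- by move=> *; rewrite mulrA.
- by move=> *; rewrite mul0r.
- by move=> *; rewrite mul1r.
- by move=> *; rewrite mulrDl.
- by move=> *; rewrite mulrDr.
- by move=> *; rewrite mulrC.
- by move=> *; rewrite mulr0.
- by move=> *; rewrite !mulr0.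
Qed.

Lemma wscal_inj a b : wcls (EScal a) = wcls (EScal b) -> a = b.
Proof. by move/wclsP/eaug_econg. Qed.

Lemma waddN : left_inverse (wcls (EScal 0)) wopp wadd.
Proof.
move=> x; rewrite -{2}[x]wmul1l -wmulDl -wscalD addNr -[x]wclsK wmulE.
by apply/wclsP; exact: econg_mul0.
Qed.

HB.instance Definition _ :=
  GRing.isZmodule.Build walg waddA waddC wadd0 waddN.

Lemma wone_neq0 : wcls (EScal 1) != 0 :> walg.
Proof. by apply/eqP => /wscal_inj/eqP; rewrite oner_eq0. Qed.

HB.instance Definition _ :=
  GRing.Zmodule_isNzRing.Build walg wmulA wmul1l wmul1r wmulDl wmulDr wone_neq0.

Lemma wscaleA a b x : wscale a (wscale b x) = wscale (a * b) x.
Proof. by rewrite /wscale wmulA -wscalM. Qed.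

Lemma wscale1 : left_id 1 wscale.
Proof. exact: wmul1l. Qed.

Lemma wscaleDr : right_distributive wscale +%R.
Proof. by move=> a x y; exact: wmulDr. Qed.

Lemma wscaleDl x : {morph wscale^~ x : a b / a + b}.
Proof. by move=> a b; rewrite /wscale wscalD; exact: wmulDl. Qed.

HB.instance Definition _ :=
  GRing.Zmodule_isLmodule.Build K walg wscaleA wscale1 wscaleDr wscaleDl.

Lemma wscaleAl (a : K) (x y : walg) : a *: (x * y) = (a *: x) * y.
Proof. exact: wmulA. Qed.

HB.instance Definition _ := GRing.Lmodule_isLalgebra.Build K walg wscaleAl.

Lemma wscaleAr (a : K) (x y : walg) : a *: (x * y) = x * (a *: y).
Proof.
transitivity (wmul (wmul (wcls (EScal a)) x) y); first exact: wmulA.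
by rewrite wmul_scalC -wmulA.
Qed.

HB.instance Definition _ := GRing.Lalgebra_isAlgebra.Build K walg wscaleAr.

Definition winj (u : double) : walg := wcls (EGen u).

(* b = x_1^* ... x_p^* y^1 ... y^q is a product of homogeneous elements of V^*
   and of V, of total degree d. *)
Definition is_prod (p q : nat) (d : int) (b : walg) : Prop :=
  exists (f : 'I_p -> dual_space) (v : 'I_q -> V)
         (df : 'I_p -> int) (dv : 'I_q -> int),
    [/\ (forall i, dual_homog (df i) (f i)),
        (forall j, v j \in gr (dv j)),
        d = \sum_i df i + \sum_j dv j + ((p + q)%:Z - 2)
      & b = (\prod_i winj (in_dual (f i))) * (\prod_j winj (in_vect (v j)))].

Definition lspan (P : walg -> Prop) (b : walg) : Prop :=
  exists (m : nat) (c : 'I_m -> K) (g : 'I_m -> walg),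
    (forall i, P (g i)) /\ b = \sum_i c i *: g i.

(* The part of total degree d of /\^p V^* (x) /\^q V. *)
Definition bipart (p q : nat) (d : int) : walg -> Prop :=
  lspan (is_prod p q d).

Definition total_homog (d : int) : walg -> Prop :=
  lspan (fun b => exists p q, is_prod p q d b).

Record is_big_bracket (br : walg -> walg -> walg) : Prop := IsBigBracket {
  bb_linl : forall b, linear (br^~ b);
  bb_linr : forall a, linear (br a);
  bb_deg : forall da db a b, total_homog da a -> total_homog db b ->
    total_homog (da + db) (br a b);
  bb_antisym : forall da db a b, total_homog da a -> total_homog db b ->
    br a b = - (ksign K da db *: br b a);
  bb_jacobi : forall da db a b c, total_homog da a -> total_homog db b ->
    br a (br b c) = br (br a b) c + ksign K da db *: br b (br a c);
  bb_scal : forall (k : K) b, br k%:A b = 0;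
  bb_pairing : forall du dv u v, double_homog du u -> double_homog dv v ->
    br (winj u) (winj v) = (pairing du dv u v)%:A;
  bb_leibniz : forall da db a b c, total_homog da a -> total_homog db b ->
    br a (b * c) = br a b * c + ksign K da db *: (b * br a c)
}.

(* A formal sum S = \sum_(k, l) s_kl is the family of its components; as the
   bracket has bidegree (-1, -1), the component (r, s) of [S, T] is the finite
   sum of the [s_kl, t_k'l'] with k + k' = r + 1 and l + l' = s + 1. *)
Definition fbracket (br : walg -> walg -> walg) (S T : nat -> nat -> walg)
    (r s : nat) : walg :=
  \sum_(k < r.+2) \sum_(l < s.+2) br (S k l) (T (r.+1 - k)%N (s.+1 - l)%N).

Record is_Linfty_bialgebra (br : walg -> walg -> walg)
    (T : nat -> nat -> walg) : Prop := IsLinftyBialgebra {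
  lb_pos : forall k l, (k == 0)%N || (l == 0)%N -> T k l = 0;
  lb_deg : forall k l, bipart k l 1 (T k l);
  lb_maurer_cartan : forall r s, fbracket br T T r s = 0
}.

End GradedSpace.

Section Symbols.
Variables (K : fieldType) (n : nat) (a : 'I_n -> int).

(* Exponents of monomials in the 2n variables x^1, ..., x^n, xi_1, ..., xi_n,
   always written in that order; a i is the degree of the basis vector e_i. *)
Definition mon := {ffun 'I_(n + n) -> nat}.

Definition xvar (i : 'I_n) : 'I_(n + n) := lshift n i.
Definition xivar (i : 'I_n) : 'I_(n + n) := rshift n i.

(* Degree of the corresponding element of V^* (+) V. *)
Definition ideg (g : 'I_(n + n)) : int :=
  match split g with inl i => - a i | inr i => a i end.

(* Degree in V^*[-1] (+) V[1], where X[1]^d = X^(d+1). *)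
Definition sdeg (g : 'I_(n + n)) : int :=
  match split g with inl i => - a i + 1 | inr i => a i - 1 end.

Definition vodd (g : 'I_(n + n)) : bool := odd `|sdeg g|%N.

Definition xdeg (m : mon) : nat := (\sum_i m (xvar i))%N.
Definition xideg (m : mon) : nat := (\sum_i m (xivar i))%N.

Definition mon_total_degree (m : mon) : int :=
  \sum_g ideg g *+ m g + ((xdeg m + xideg m)%:Z - 2).

Definition mon_parity (m : mon) : bool := odd (\sum_(g | vodd g) m g).

(* Odd variables square to zero. *)
Definition admissible (m : mon) : bool := [forall g, vodd g ==> (m g <= 1)%N].

(* Formal power series, given by their coefficients. *)
Definition series := mon -> K.

Definition is_symbol (E : series) : Prop :=
  forall m, ~~ admissible m -> E m = 0.

(* z^m1 z^m2 = mon_sign m1 m2 z^(m1 + m2) *)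
Definition mon_sign (m1 m2 : mon) : K :=
  (-1) ^+ (\sum_(g | vodd g) \sum_(h | vodd h && (h < g)) m1 g * m2 h)%N.

Definition mon_of (N : nat) (mu : {ffun 'I_(n + n) -> 'I_N}) : mon :=
  [ffun g => mu g : nat].

Definition mon_sub (m m1 : mon) : mon := [ffun g => m g - m1 g]%N.

Definition mon_incr (g : 'I_(n + n)) (m : mon) : mon :=
  [ffun h => m h + (h == g)]%N.

Definition smul (E F : series) : series := fun m =>
  if admissible m then
    \sum_(mu : {ffun 'I_(n + n) -> 'I_(\sum_g m g).+1}
          | [forall g, (mu g <= m g)%N])
       mon_sign (mon_of mu) (mon_sub m (mon_of mu)) *
       E (mon_of mu) * F (mon_sub m (mon_of mu))
  else 0.

Definition lderiv (g : 'I_(n + n)) (E : series) : series := fun m =>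
  (-1) ^+ (vodd g * \sum_(h | vodd h && (h < g)) m h)%N *
  (m g).+1%:R * E (mon_incr g m).

Definition rderiv (g : 'I_(n + n)) (E : series) : series := fun m =>
  (-1) ^+ (vodd g * \sum_(h | vodd h && (g < h)) m h)%N *
  (m g).+1%:R * E (mon_incr g m).

Definition parity_part (p : bool) (E : series) : series := fun m =>
  if mon_parity m == p then E m else 0.

(* {E, F} = dE/dx^i dF/dxi_i - (-1)^(deg E deg F) dF/dx^i dE/dxi_i, extended
   bilinearly from the elements of pure parity; right derivatives with respect
   to x and left derivatives with respect to xi. *)
Definition poisson (E F : series) : series := fun m =>
  \sum_i
    (smul (rderiv (xvar i) E) (lderiv (xivar i) F) m -
     \sum_(p : bool) \sum_(q : bool)
       (-1) ^+ (p && q) *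
       smul (rderiv (xvar i) (parity_part q F))
            (lderiv (xivar i) (parity_part p E)) m).

End Symbols.

Section Correspondence.
Variables (K : fieldType) (V : vectType K) (gr : int -> {vspace V}).
Variables (n : nat) (e : n.-tuple V).

Definition dual_coord (i : 'I_n) : dual_space V := linfun (coord e i : V -> K^o).

(* x^I xi_J |-> (e^* )^I /\ e^J.  As the relations of walg are those of the
   symmetric algebra on the shifted space, the identification of
   Sym^k (V^*[-1]) (x) Sym^l (V[1]) with /\^k V^* (x) /\^l V has no sign. *)
Definition mon_elt (m : mon n) : walg gr :=
  (\prod_i winj gr (in_dual (dual_coord i)) ^+ m (xvar i)) *
  (\prod_i winj gr (in_vect (tnth e i)) ^+ m (xivar i)).

(* The element of /\^k V^* (x) /\^l V given by the component Q_kl, that is by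
   the terms of degree k in the x's and l in the xi's. *)
Definition component_elt (k l : nat) (Q : series K n) : walg gr :=
  \sum_(mu : {ffun 'I_(n + n) -> 'I_(k + l).+1}
        | (xdeg (mon_of mu) == k) && (xideg (mon_of mu) == l))
     Q (mon_of mu) *: mon_elt (mon_of mu).

End Correspondence.

(* Main.v *)
(** The bracket itself provides the calculus.  If z^g and z^h are generators of
    the algebra dual to each other under the pairing, [z^h, _] is up to sign the
    left derivative with respect to z^g.  Iterated derivatives followed by the
    augmentation separate the admissible monomials, which are therefore linearly
    independent; as they also span, the components t_kl are the same thing as a
    symbol Q.  The Leibniz rule gives the chain rule
      [x, y] = sum_g [x, z^g] (d y / d z^g),
    and for x, y of odd total degree this is
      sum_i (d_{x^i} x) (d_{xi_i} y) + (d_{x^i} y) (d_{xi_i} x).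
    Summing over bidegrees turns [T, T] = 0 into {Q, Q} = 0, left and right
    derivatives agreeing on odd symbols. *)

From HB Require Import structures.
Require Import Defs.
From mathcomp Require Import all_boot all_algebra.
From mathcomp Require Import boolp reals zify ring.
From mathcomp.real_closed Require Import complex.

Set Implicit Arguments.
Unset Strict Implicit.
Unset Printing Implicit Defensive.

Import GRing.Theory Num.Theory.
Local Open Scope ring_scope.

Lemma odd_abszD (x y : int) : odd (absz (x + y)%R) = odd `|x|%N (+) odd `|y|%N.
Proof. lia. Qed.

(** * Ordered products in an algebra whose generators commute up to sign *)

Section OrderedProducts.
Variables (K : fieldType) (A : algType K).

Lemma skew_sym (x y : A) (s : nat) :
  x * y = (-1) ^+ s *: (y * x) -> y * x = (-1) ^+ s *: (x * y).
Proof. by move=> ->; rewrite scalerA -exprD -signr_odd oddD addbb scale1r. Qed.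

Lemma skew_expl (x y : A) (s k : nat) :
  x * y = (-1) ^+ s *: (y * x) -> x ^+ k * y = (-1) ^+ (s * k) *: (y * x ^+ k).
Proof.
move=> h; elim: k => [|k IH]; first by rewrite muln0 scale1r mul1r mulr1.
rewrite exprS -mulrA IH -scalerAr (mulrA x) h -scalerAl scalerA -exprD mulnS.
by rewrite addnC -mulrA.
Qed.

Lemma skew_prodl (I : Type) (s : seq I) (G : I -> A) (b : I -> nat) y :
  (forall i, G i * y = (-1) ^+ b i *: (y * G i)) ->
  (\prod_(i <- s) G i) * y
    = (-1) ^+ (\sum_(i <- s) b i) *: (y * \prod_(i <- s) G i).
Proof.
move=> h; elim: s => [|i s IH]; first by rewrite !big_nil scale1r mul1r mulr1.
rewrite !big_cons -mulrA IH -scalerAr (mulrA (G i)) h -scalerAl scalerA -exprD.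
by rewrite addnC -mulrA.
Qed.

(** Induction that splits off the last factor: the left power of [G ord_max] must cross every factor
    of the second product, and crossing the odd ones produces the terms [g = ord_max] of the
    exponent. The sign is that of [mon_sign]. *)
Lemma ordprod_mul N (G : 'I_N -> A) (od : pred 'I_N) (m1 m2 : 'I_N -> nat) :
  (forall i j, G i * G j = (-1) ^+ (od i && od j) *: (G j * G i)) ->
  (\prod_i G i ^+ m1 i) * (\prod_i G i ^+ m2 i)
  = (-1) ^+ (\sum_(g | od g) \sum_(h | od h && (h < g)) m1 g * m2 h)%N
      *: \prod_i G i ^+ (m1 i + m2 i).
Proof.
elim: N G od m1 m2 => [|N IH] G od m1 m2 hG.
  by rewrite !big_ord0 scale1r mulr1.
rewrite !big_ord_recr /= exprD.
set P1 := \prod_(i < N) _ ^+ m1 _; set P2 := \prod_(i < N) _ ^+ m2 _.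
set a := G ord_max ^+ m1 _; set b := G ord_max ^+ m2 _.
pose w i := widen_ord (leqnSn N) i.
have hc : P2 * a = (-1) ^+ (\sum_(i < N) (od ord_max && od (w i)) * m1 ord_max *
    m2 (w i))%N *: (a * P2).
  apply: skew_prodl => i; rewrite /a.
  by apply/skew_expl/skew_sym/skew_expl; exact: hG.
have hc' := skew_sym hc.
rewrite -mulrA (mulrA a) hc' -scalerAl -scalerAr -mulrA (mulrA P1).
rewrite (IH (fun i => G (w i)) (fun i => od (w i))) //.
rewrite -scalerAl scalerA -exprD; congr (_ ^+ _ *: (_ * _)).
rewrite addnC big_mkcond [RHS]big_mkcond big_ord_recr /=.
congr (_ + _)%N.
  apply: eq_bigr => g _; case: ifP => // _.
  rewrite [LHS]big_mkcond [RHS]big_mkcond big_ord_recr /=.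
  by rewrite [(N < g)%N]ltnNge (ltnW (ltn_ord g)) andbF addn0.
case: (od ord_max) => /=; last by rewrite big1.
rewrite [RHS]big_mkcond big_ord_recr /= ltnn andbF addn0.
apply: eq_bigr => i _; rewrite ltn_ord andbT.
by case: (od _); rewrite /= ?mul0n // mul1n.
Qed.

Section Derivation.
Variables (N : nat) (G : 'I_N -> A) (od : pred 'I_N) (g : 'I_N) (D : A -> A).
Hypotheses (D1 : D 1 = 0)
  (DG : forall h w,
     D (G h * w) = (g == h)%:R *: w + (-1) ^+ (od g && od h) *: (G h * D w)).

Lemma deriv_expn h k w : h != g ->
  D (G h ^+ k * w) = (-1) ^+ ((od g && od h) * k) *: (G h ^+ k * D w).
Proof.
move=> hg; elim: k => [|k IH]; first by rewrite muln0 scale1r !mul1r.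
rewrite exprS -mulrA DG eq_sym (negbTE hg) scale0r add0r IH -scalerAr scalerA.
by rewrite -exprD mulnS -mulrA.
Qed.

(** For odd [g] the Leibniz terms alternate in sign, so the factor [k.+1] is guaranteed only for the
    first power; hence the restriction to [k = 0]. *)
Lemma deriv_expg k w : D w = 0 -> (od g -> k = 0)%N ->
  D (G g ^+ k.+1 * w) = k.+1%:R *: (G g ^+ k * w).
Proof.
move=> Dw; case: (boolP (od g)) => [og /(_ isT) ->|og _].
  by rewrite !mul1r DG eqxx Dw mulr0 scaler0 addr0.
elim: k => [|k IH]; first by rewrite !mul1r DG eqxx Dw mulr0 scaler0 addr0.
rewrite exprS -mulrA DG eqxx IH (negbTE og) scale1r scale1r -scalerAr mulrA.
by rewrite -exprS -[k.+2]add1n natrD scalerDl scale1r.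
Qed.

Lemma deriv_ordprod0 (s : seq 'I_N) (m : 'I_N -> nat) : g \notin s ->
  D (\prod_(h <- s) G h ^+ m h) = 0.
Proof.
elim: s => [|h s IH]; first by rewrite big_nil.
rewrite inE negb_or big_cons eq_sym => /andP[hg gs].
by rewrite deriv_expn // IH // mulr0 scaler0.
Qed.

(** [D] crosses the factors before [g], gaining a sign at each odd one when [g] is odd, acts on the
    factor of [g], and kills everything after it. Sortedness turns precedence in the list into
    [h < g]; a general list in place of the full enumeration makes the induction possible. *)
Lemma deriv_ordprod (s : seq 'I_N) (m : 'I_N -> nat) :
    pairwise (fun h k : 'I_N => h < k)%N s -> g \in s -> (od g -> m g = 0)%N ->
  D (\prod_(h <- s) G h ^+ (m h + (h == g)))
  = ((-1) ^+ (od g * \sum_(h <- s | od h && (h < g)%N) m h)%N * (m g).+1%:R)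
      *: \prod_(h <- s) G h ^+ m h.
Proof.
move=> hs gs mg; elim: s hs gs => //= h s IH /andP[hlt hs].
rewrite inE !big_cons; case: (eqVneq h g) => [hg _|hg].
  subst h.
  have gs : g \notin s by apply/negP => /(allP hlt); rewrite ltnn.
  rewrite addn1 ltnn andbF [X in (od g * X)%N]big1_seq ?muln0 ?mul1r; last first.
    move=> k /andP[/andP[_ kg] ks]; have := allP hlt _ ks.
    by rewrite ltnNge (ltnW kg).
  rewrite deriv_expg //; last exact: deriv_ordprod0.
  congr (_ *: (_ * _)); apply: eq_big_seq => k ks.
  case: eqVneq => [E|_]; last by rewrite addn0.
  by rewrite -E ks in gs.
rewrite /= => gs.
rewrite addn0 deriv_expn // IH // -scalerAr scalerA (allP hlt _ gs) andbT.
rewrite mulrA -exprD; congr ((_ * _) *: _).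
by case: (od g); case: (od h); rewrite ?mul1n ?mul0n ?add0n.
Qed.

End Derivation.
End OrderedProducts.

(** * The bigraded algebra *)

(** Linear combinations are built one term at a time, so that linear statements about the elements
    of an [lspan] can be proved by induction. *)
Inductive spanned (K : fieldType) (U : lmodType K) (P : U -> Prop) : U -> Prop :=
  | spanned0 : spanned P 0
  | spannedD c x y : P x -> spanned P y -> spanned P (c *: x + y).

Section Spanned.
Variables (K : fieldType) (U : lmodType K).
Implicit Types P Q : U -> Prop.

Lemma spanned_gen P x : P x -> spanned P x.
Proof.
by move=> Px; rewrite -[x]addr0 -[x]scale1r; apply: spannedD Px (spanned0 _).
Qed.

Lemma spanned_lin P c x y : spanned P x -> spanned P y -> spanned P (c *: x + y).
Proof.
move=> + hy; elim=> [|d u v Pu _ IH]; first by rewrite scaler0 add0r.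
by rewrite scalerDr scalerA -addrA; apply: spannedD.
Qed.

Lemma spannedZ P c x : spanned P x -> spanned P (c *: x).
Proof.
by move=> hx; rewrite -[_ *: _]addr0; apply: spanned_lin hx (spanned0 _).
Qed.

Lemma spanned_sum P (I : Type) (r : seq I) (F : I -> U) :
  (forall i, spanned P (F i)) -> spanned P (\sum_(i <- r) F i).
Proof.
move=> h; elim: r => [|i r IH]; first by rewrite big_nil; constructor.
by rewrite big_cons -[F i]scale1r; apply: spanned_lin.
Qed.

Lemma spanned_sub P Q x :
  (forall y, P y -> spanned Q y) -> spanned P x -> spanned Q x.
Proof.
move=> PQ; elim=> [|c u v Pu _ IH]; first exact: spanned0.
by apply: spanned_lin => //; apply: PQ.
Qed.

End Spanned.

Lemma spanned_mul (K : fieldType) (A : algType K) (P Q R : A -> Prop) x y :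
  (forall u v, P u -> Q v -> spanned R (u * v)) ->
  spanned P x -> spanned Q y -> spanned R (x * y).
Proof.
move=> PQR hx hy; elim: hx => [|c u v Pu _ IH].
  by rewrite mul0r; apply: spanned0.
rewrite mulrDl -scalerAl; apply: spanned_lin => //.
elim: hy {IH} => [|d u' v' Qu' _ IH]; first by rewrite mulr0; apply: spanned0.
by rewrite mulrDr -scalerAr; apply: spanned_lin => //; apply: PQR.
Qed.

Lemma lspan_spanned (K : fieldType) (V : vectType K) (gr : int -> {vspace V})
    (P : walg gr -> Prop) x : lspan P x -> spanned P x.
Proof.
move=> [m [c [g [Pg ->]]]]; apply: spanned_sum => i.
by apply/spannedZ/spanned_gen.
Qed.

(** * Augmentation and graded commutativity of [walg] *)

Section BigradedAlgebra.
Variables (K : fieldType) (V : vectType K) (gr : int -> {vspace V}).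
Local Notation W := (walg gr).
Local Notation winj := (winj gr).

(** The constant term: [eaug] respects the defining relations, so any representative gives the same
    value. *)
Definition waug (x : W) : K := eaug (repr x).

Lemma waug_wcls s : waug (wcls gr s) = eaug s.
Proof. exact/eaug_econg/econg_repr. Qed.

Lemma wcls_add s t : wcls gr (EAdd s t) = wcls gr s + wcls gr t.
Proof. by rewrite -waddE. Qed.

Lemma wcls_mul s t : wcls gr (EMul s t) = wcls gr s * wcls gr t.
Proof. by rewrite -wmulE. Qed.

Lemma wcls_scale c s : wcls gr (EMul (EScal V c) s) = c *: wcls gr s.
Proof. by rewrite -wmulE. Qed.

Lemma waug_scalar : scalar waug.
Proof.
move=> c x y; rewrite -[x]wclsK -[y]wclsK -wcls_scale -wcls_add.
by rewrite !waug_wcls.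
Qed.

Lemma waugM x y : waug (x * y) = waug x * waug y.
Proof. by rewrite -[x]wclsK -[y]wclsK -wcls_mul !waug_wcls. Qed.

Lemma waug1 : waug 1 = 1.
Proof. exact: waug_wcls. Qed.

Lemma waug_winj u : waug (winj u) = 0.
Proof. exact: waug_wcls. Qed.

Lemma winj_linear : linear winj.
Proof.
move=> c u v; rewrite /Defs.winj -wcls_scale -wcls_add; apply/wclsP.
apply: econg_trans (econg_genD _ _ _) _.
by apply: econg_add (econg_genZ _ _ _) (econg_refl _ _).
Qed.
HB.instance Definition _ := GRing.isLinear.Build K (Defs.double V) W _ winj winj_linear.

Lemma ksignE (d1 d2 : int) :
  ksign K d1 d2 = (-1) ^+ (odd (absz d1) && odd (absz d2)).
Proof. by []. Qed.

Lemma ksign_sqr d1 d2 : ksign K d1 d2 * ksign K d1 d2 = 1.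
Proof. by rewrite /ksign -expr2 sqrr_sign. Qed.

Lemma ksignC d1 d2 : ksign K d1 d2 = ksign K d2 d1.
Proof. by rewrite /ksign andbC. Qed.

Lemma winj_comm du dv u v : double_homog gr du u -> double_homog gr dv v ->
  winj u * winj v = ksign K (du - 1) (dv - 1) *: (winj v * winj u).
Proof.
move=> hu hv; rewrite -!wcls_mul -wcls_scale; apply/wclsP.
exact: econg_koszul.
Qed.

Lemma dual_double d f : dual_homog gr d f -> double_homog gr d (in_dual f).
Proof. by split=> //=; rewrite mem0v. Qed.

Lemma vect_double d v : v \in gr d -> double_homog gr d (in_vect v).
Proof. by split=> //= b w _ _; rewrite lfunE. Qed.

Lemma winj_total_homog d u : double_homog gr d u ->
  total_homog (d - 1) (winj u).
Proof.
case: u => f v [/= hf hv].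
(* The form part and the vector part of [u] are products with a single factor, so the shift
   [p + q - 2] is [-1] for both. *)
exists 2, (fun _ => 1), (fun i => if i == ord0 then winj (in_dual f)
                                  else winj (in_vect v)); split; last first.
  rewrite !big_ord_recl big_ord0 /= addr0 !scale1r -raddfD.
  by congr winj; rewrite /in_dual /in_vect; congr (_, _); rewrite /= ?addr0 ?add0r.
move=> i; case: ifP => _.
  exists 1, 0, (fun _ => f), (fun _ => 0), (fun _ => d), (fun _ => 0).
  split=> //; first by case.
    by rewrite big_ord_recl !big_ord0 !addr0 //.
  by rewrite big_ord_recl !big_ord0 !mulr1.
exists 0, 1, (fun _ => 0), (fun _ => v), (fun _ => 0), (fun _ => d).
split=> //; first by case.
  by rewrite big_ord_recl !big_ord0 !addr0 add0r //.
by rewrite big_ord_recl !big_ord0 mul1r mulr1.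
Qed.

Lemma one_total_homog : total_homog (- 2) (1 : W).
Proof.
exists 1, (fun _ => 1), (fun _ => 1); split; last first.
  by rewrite big_ord_recl big_ord0 scale1r addr0.
(* The empty product, whose total degree is only the shift [-2]. *)
move=> _; exists 0, 0, (fun _ => 0), (fun _ => 0), (fun _ => 0), (fun _ => 0).
by split; [case|case|rewrite !big_ord0|rewrite !big_ord0 mulr1].
Qed.

Lemma total_homogZ d c (x : W) : total_homog d x -> total_homog d (c *: x).
Proof.
move=> [m [cf [g [h ->]]]]; exists m, (fun i => c * cf i), g; split=> //.
by rewrite scaler_sumr; apply: eq_bigr => i _; rewrite scalerA.
Qed.

Lemma bipart_total_homog p q d (x : W) : bipart p q d x -> total_homog d x.
Proof.
move=> [m [cf [g [h ->]]]]; exists m, cf, g; split=> // i.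
by exists p, q.
Qed.

Lemma skew_spanned (P : W -> Prop) c (x y : W) :
  (forall u, P u -> u * y = c *: (y * u)) -> spanned P x ->
  x * y = c *: (y * x).
Proof.
move=> h; elim=> [|d u v Pu _ IH]; first by rewrite mul0r mulr0 scaler0.
rewrite mulrDl mulrDr -scalerAl -scalerAr (h _ Pu) IH scalerDr !scalerA.
by rewrite mulrC.
Qed.

(** The factors of [x] cross [y] one at a time. Modulo 2 the shift [p + q - 2] adds one to the
    degree of each factor, so [d] has the parity of the sum of their total degrees. *)
Lemma is_prod_skew p q d (x y : W) (c : int) : is_prod p q d x ->
  (forall du u, double_homog gr du u ->
     winj u * y = ksign K c (du - 1) *: (y * winj u)) ->
  x * y = ksign K c d *: (y * x).
Proof.
move=> [f [v [df [dv [hf hv -> ->]]]]] hy.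
have h1 := @skew_prodl K W _ (index_enum 'I_p) (fun i => winj (in_dual (f i)))
  (fun i => odd (absz c) && odd (absz (df i - 1)%R)) y.
have h2 := @skew_prodl K W _ (index_enum 'I_q) (fun i => winj (in_vect (v i)))
  (fun i => odd (absz c) && odd (absz (dv i - 1)%R)) y.
rewrite -mulrA {}h2; last by move=> i; apply/hy/vect_double.
rewrite -scalerAr (mulrA _ y) {}h1; last by move=> i; apply/hy/dual_double.
rewrite -scalerAl scalerA -mulrA -exprD; congr (_ *: _).
rewrite ksignE -[LHS]signr_odd; congr (_ ^+ nat_of_bool _).
have odds (I : finType) (b : bool) (e : I -> int) :
    odd (\sum_i (b && odd (absz (e i - 1)%R))%N)
    = b && odd (absz (\sum_i e i + #|I|%:Z)%R).
  rewrite -[LHS]/(odd _) (big_morph odd oddD (erefl : odd 0 = false)).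
  under eq_bigr do rewrite oddb.
  case: b => /=; last by rewrite big1_eq.
  have -> : \sum_i e i + #|I|%:Z = \sum_i (e i + 1).
    by rewrite big_split /= sumr_const natz.
  rewrite (big_morph (fun x : int => odd (absz x)) odd_abszD
    (erefl : odd (absz 0) = false)).
  by apply: eq_bigr => i _; rewrite !odd_abszD abszN.
rewrite oddD !odds !card_ord -andb_addr; congr (_ && _).
by rewrite !odd_abszD abszN !absz_nat oddD; do 4!case: (odd _).
Qed.

Lemma total_homog_skew d d' (x y : W) : total_homog d x -> total_homog d' y ->
  x * y = ksign K d d' *: (y * x).
Proof.
move=> /lspan_spanned hx /lspan_spanned hy; rewrite ksignC.
apply: skew_spanned hx => u [p [q hu]]; apply: is_prod_skew hu _ => du w hw.
rewrite ksignC; set s := ksign _ _ _.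
(* The same argument now runs on the factors of [y], with the two sides exchanged; a Koszul sign is
   its own inverse. *)
suff -> : y * winj w = s *: (winj w * y) by rewrite scalerA ksign_sqr scale1r.
apply: skew_spanned hy => z [p' [q' hz]].
apply: is_prod_skew hz _ => du' w' hw'.
by rewrite ksignC; apply: winj_comm.
Qed.

End BigradedAlgebra.

(** * Generators attached to a homogeneous basis *)

Section HomogeneousBasis.
Variables (K : fieldType) (V : vectType K) (gr : int -> {vspace V}).
Hypothesis Hgr : is_grading gr.
Variables (n : nat) (e : n.-tuple V) (a : 'I_n -> int).
Hypotheses (He : basis_of fullv e) (Ha : forall i, tnth e i \in gr (a i)).

Lemma coord_expand v : v = \sum_i coord e i v *: tnth e i.
Proof.
rewrite {1}(coord_basis He (memvf v)); apply: eq_bigr => i _.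
by rewrite (tnth_nth 0).
Qed.

Lemma coord_tnth i j : coord e i (tnth e j) = (i == j)%:R.
Proof. by rewrite (tnth_nth 0) coord_free ?(basis_free He) // eq_sym. Qed.

(** Group the expansion of [v] by the degrees of the basis vectors and subtract [v] in degree [b]:
    the result is a family of homogeneous vectors with sum zero, and each vanishes because the sum
    is direct. In degree [a j], when it differs from [b], freeness then kills the coordinate. *)
Lemma coord_homog b v j : v \in gr b -> coord e j v != 0 -> a j = b.
Proof.
move=> vb cj; apply/eqP; apply: contraNT cj => ajb.
have [s [us s0 _ ds]] := Hgr.
have e0 i : tnth e i != 0 by apply: (free_not0 (basis_free He)); exact: mem_tnth.
have as_ i : a i \in s.
  apply: contraT => /s0 h; move: (Ha i).
  by rewrite h memv0 (negbTE (e0 i)).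
pose t (k : 'I_(size s)) := nth 0 s k.
have {}ds : directv (\sum_(k < size s) gr (t k)).
  have sum_t (R : Type) (op : R -> R -> R) idx (F : int -> R) :
      \big[op/idx]_(k < size s) F (t k) = \big[op/idx]_(d <- s) F d.
    by rewrite (big_nth (0 : int)) big_mkord.
  apply/directvP; rewrite /= (sum_t _ _ _ gr) (sum_t _ _ _ (fun d => \dim (gr d))).
  exact: directvP ds.
pose w d := \sum_(i | a i == d) coord e i v *: tnth e i.
pose u (k : 'I_(size s)) := w (t k) - (if t k == b then v else 0).
have ub k : true -> u k \in gr (t k).
  move=> _; rewrite memvB //.
    by apply: memv_suml => i /eqP <-; apply/memvZ/Ha.
  by case: eqP => [->|_] //; rewrite mem0v.
have sumw : \sum_(d <- s) w d = v.
  rewrite [RHS]coord_expand /w (exchange_big_dep predT) //=.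
  apply: eq_bigr => i _.
  rewrite -big_filter (_ : [seq d <- s | _] = [:: a i]) ?big_seq1 //.
  rewrite -(filter_pred1_uniq us (as_ i)); apply: eq_filter => d.
  exact: eq_sym.
have sumb : \sum_(d <- s) (if d == b then v else 0) = v.
  rewrite -big_mkcond; case: (boolP (b \in s)) => bs.
    by rewrite -big_filter filter_pred1_uniq // big_seq1.
  by move: vb; rewrite s0 // memv0 => /eqP ->; rewrite big1.
have u0 : \sum_k u k = 0.
  have tsum (F : int -> V) : \sum_k F (t k) = \sum_(d <- s) F d.
    by rewrite (big_nth 0) big_mkord.
  by rewrite sumrB (tsum w) (tsum (fun d => if d == b then v else 0)) sumw sumb subrr.
have js : (index (a j) s < size s)%N by rewrite index_mem.
have := directv_sum_independent ds u ub u0 (Ordinal js) isT.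
rewrite /u /t /= nth_index // (negbTE ajb) subr0 /w big_mkcond /= => w0.
have := freeP (basis_free He) (fun i => if a i == a j then coord e i v else 0).
move=> /(_ _ j); rewrite eqxx => -> //; rewrite -[RHS]w0.
by apply: eq_bigr => i _; case: ifP => _; rewrite ?scale0r // (tnth_nth 0).
Qed.

Lemma dual_coordE i v : dual_coord e i v = coord e i v.
Proof. exact: lfunE. Qed.

Lemma dual_coord_homog i : dual_homog gr (- a i) (dual_coord e i).
Proof.
move=> b v; rewrite opprK dual_coordE => bi vb; apply/eqP.
by apply: contraNT bi => /(coord_homog vb) ->.
Qed.

Lemma dual_expand (f : dual_space V) :
  f = \sum_i f (tnth e i) *: dual_coord e i.
Proof.
apply/lfunP => v; rewrite {1}[v]coord_expand linear_sum sum_lfunE.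
by apply: eq_bigr => i _; rewrite linearZ scale_lfunE dual_coordE; exact: mulrC.
Qed.

Definition gen_double (g : 'I_(n + n)) : Defs.double V :=
  match split g with
  | inl i => in_dual (dual_coord e i)
  | inr i => in_vect (tnth e i)
  end.

Local Notation W := (walg gr).
Definition gen (g : 'I_(n + n)) : W := winj gr (gen_double g).

(* The index of the variable dual to z^g under the pairing. *)
Definition conj_var (g : 'I_(n + n)) : 'I_(n + n) :=
  match split g with inl i => xivar i | inr i => xvar i end.

Lemma split_lshift (i : 'I_n) : split (lshift n i) = inl i.
Proof. exact: (@unsplitK n n (inl i)). Qed.

Lemma split_rshift (i : 'I_n) : split (rshift n i) = inr i.
Proof. exact: (@unsplitK n n (inr i)). Qed.

Definition splitE := (split_lshift, split_rshift).

Lemma gen_double_homog g : double_homog gr (ideg a g) (gen_double g).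
Proof.
rewrite /ideg /gen_double; case: split => i.
  exact/dual_double/dual_coord_homog.
exact/vect_double/Ha.
Qed.

(** For a [xi] the two degrees agree; for an [x] they are [-a - 1] and [-a + 1]. Hence total degree
    and symbol degree give the same signs. *)
Lemma odd_ideg g : odd (absz (ideg a g - 1)%R) = vodd a g.
Proof.
by rewrite /vodd /sdeg /ideg; case: split => i;
  rewrite !(odd_abszD, abszN).
Qed.

Lemma vodd_conj g : vodd a (conj_var g) = vodd a g.
Proof.
rewrite /conj_var -!odd_ideg /ideg.
by case: (split_ordP g) => i _; rewrite /xvar /xivar !splitE !(odd_abszD, abszN).
Qed.

Lemma gen_comm g h :
  gen g * gen h = (-1) ^+ (vodd a g && vodd a h) *: (gen h * gen g).
Proof.
rewrite /gen (winj_comm (gen_double_homog g) (gen_double_homog h)).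
by rewrite ksignE !odd_ideg.
Qed.

Lemma gen_total_homog g : total_homog (ideg a g - 1) (gen g).
Proof. exact/winj_total_homog/gen_double_homog. Qed.

Lemma mon_eltE m : mon_elt gr e m = \prod_g gen g ^+ m g.
Proof.
rewrite big_split_ord /mon_elt; congr (_ * _); apply: eq_bigr => i _;
  by rewrite /gen /gen_double !splitE.
Qed.

Definition mon0 : mon n := [ffun _ => 0%N].
Definition mon_add (m1 m2 : mon n) : mon n := [ffun g => (m1 g + m2 g)%N].

Lemma mon_elt0 : mon_elt gr e mon0 = 1.
Proof. by rewrite mon_eltE big1 // => g _; rewrite ffunE. Qed.

Lemma mon_elt_gen g : mon_elt gr e (mon_incr g mon0) = gen g.
Proof.
rewrite mon_eltE -(expr1 (gen g)).
have -> : \prod_h gen h ^+ mon_incr g mon0 h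
        = \prod_h (if h == g then gen g else 1).
  by apply: eq_bigr => h _; rewrite !ffunE; case: eqP => [->|].
by rewrite -big_mkcond big_pred1_eq.
Qed.

Lemma mon_elt_mul m1 m2 : mon_elt gr e m1 * mon_elt gr e m2
  = mon_sign K a m1 m2 *: mon_elt gr e (mon_add m1 m2).
Proof.
rewrite !mon_eltE (@ordprod_mul _ _ _ gen (vodd a)); last exact: gen_comm.
by congr (_ *: _); apply: eq_bigr => g _; rewrite ffunE.
Qed.

Lemma xdeg_add m1 m2 : xdeg (mon_add m1 m2) = (xdeg m1 + xdeg m2)%N.
Proof.
by rewrite /xdeg -big_split; apply: eq_bigr => i _; rewrite ffunE.
Qed.

Lemma xideg_add m1 m2 : xideg (mon_add m1 m2) = (xideg m1 + xideg m2)%N.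
Proof.
by rewrite /xideg -big_split; apply: eq_bigr => i _; rewrite ffunE.
Qed.

(** Each of the two total degrees contains its own [-2], whereas that of the product contains only
    one. *)
Lemma mon_total_degree_add m1 m2 : mon_total_degree a (mon_add m1 m2)
  = mon_total_degree a m1 + mon_total_degree a m2 + 2.
Proof.
rewrite /mon_total_degree xdeg_add xideg_add.
have -> : \sum_g ideg a g *+ mon_add m1 m2 g
    = \sum_g ideg a g *+ m1 g + \sum_g ideg a g *+ m2 g.
  by rewrite -big_split; apply: eq_bigr => g _; rewrite ffunE mulrnDr.
lia.
Qed.

Lemma sum_mon (m : mon n) : (\sum_g m g = xdeg m + xideg m)%N.
Proof. by rewrite big_split_ord. Qed.

(** Counting odd variables amounts to adding the total degrees [ideg g - 1] of the factors modulo 2,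
    and the rest of the total degree is even. This makes a component of total degree 1 an odd
    symbol. *)
Lemma mon_parityE m : mon_parity a m = odd (absz (mon_total_degree a m)).
Proof.
have -> : mon_total_degree a m = \sum_g (ideg a g - 1) *+ m g
    + ((xdeg m + xideg m)%N%:Z *+ 2 - 2).
  rewrite /mon_total_degree.
  have -> : \sum_g ideg a g *+ m g
      = \sum_g (ideg a g - 1) *+ m g + (\sum_g m g)%N%:Z.
    rewrite (big_morph Posz PoszD (erefl : Posz 0 = 0)) -big_split.
    by apply: eq_bigr => g _ /=; rewrite mulrnBl natz subrK.
  rewrite sum_mon; lia.
rewrite odd_abszD (_ : odd (absz (_ *+ 2 - 2)%R) = false) ?addbF; last first.
  by rewrite odd_abszD abszN mulr2n odd_abszD addbb.
rewrite (big_morph (fun x : int => odd (absz x)) odd_abszD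
  (erefl : odd (absz 0) = false)).
rewrite /mon_parity (big_morph odd oddD (erefl : odd 0 = false)) big_mkcond.
apply: eq_bigr => g _ /=; rewrite -mulr_natr abszM oddM odd_ideg natz absz_nat.
by case: vodd.
Qed.

(** * Derivatives and the chain rule *)

Variable br : walg gr -> walg gr -> walg gr.
Hypothesis Hbr : is_big_bracket br.
Hypothesis natK : forall k, k.+1%:R != 0 :> K.

Local Notation mon_elt := (Defs.mon_elt gr e).
Local Notation vodd := (Defs.vodd a).
Local Notation admissible := (Defs.admissible a).

(** Normalises [gen_deriv g] so that it sends [gen g] to 1. A coordinate paired with its basis
    vector gives 1; in the reverse order the value is [(-1)^(a i)], which the degree shift turns
    into [- (-1) ^+ vodd g]. *)
Definition deriv_sign (g : 'I_(n + n)) : K :=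
  match split g with inl _ => - (-1) ^+ vodd g | inr _ => 1 end.

(* The left partial derivative with respect to z^g. *)
Definition gen_deriv (g : 'I_(n + n)) (w : W) : W :=
  deriv_sign g *: br (gen (conj_var g)) w.

Lemma deriv_sign_sqr g : deriv_sign g * deriv_sign g = 1.
Proof.
rewrite /deriv_sign; case: split => _; last by rewrite mulr1.
by rewrite mulrNN -expr2 sqrr_sign.
Qed.

Lemma bracket0r x : br x 0 = 0.
Proof. by have := bb_linr Hbr x (-1) 0 0; rewrite scaler0 addr0 scaleN1r addNr. Qed.

Lemma bracket_genE g h :
  br (gen (conj_var g)) (gen h) = (deriv_sign g * (g == h)%:R)%:A.
Proof.
rewrite /gen (bb_pairing Hbr (gen_double_homog _)
  (gen_double_homog _)); congr (_ *: _).
rewrite /pairing /deriv_sign /conj_var /gen_double /vodd /sdeg /ideg.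
case: (split_ordP g) => i ->; case: (split_ordP h) => j ->;
  rewrite /xvar /xivar !splitE /=.
- rewrite dual_coordE coord_tnth // lfunE /= add0r eq_lshift eq_sym.
  case: eqP => [->|_]; rewrite ?mulr0 // /ksign abszN andbb !mulr1.
  by rewrite odd_abszD abszN addbT signrN opprK.
- by rewrite !lfunE /= mulr0 addr0 eq_lrshift mulr0.
- by rewrite !linear0 mulr0 addr0 eq_rlshift mulr0.
by rewrite dual_coordE coord_tnth // lfunE mulr0 addr0 eq_rshift mul1r.
Qed.

Lemma gen_deriv_linear g : linear (gen_deriv g).
Proof.
move=> c x y; rewrite /gen_deriv (bb_linr Hbr) scalerDr !scalerA.
by rewrite (mulrC c).
Qed.

(** Leibniz for [1 * 1]: as 1 has even total degree [-2], no sign appears and [br x 1] equals twice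
    itself. *)
Lemma bracket_1r d x : total_homog d x -> br x 1 = 0.
Proof.
move=> hx; have := bb_leibniz Hbr 1 hx (one_total_homog gr).
rewrite /ksign andbF !mulr1 scale1r mul1r => E.
by apply: (addIr (br x 1)); rewrite add0r -E.
Qed.

Lemma gen_deriv1 g : gen_deriv g 1 = 0.
Proof.
rewrite /gen_deriv (bracket_1r (gen_total_homog _)) ?scaler0 //.
Qed.

(** Supplies the hypothesis [DG] of the section on derivations. [gen (conj_var g)] has the parity of
    [gen g], so the Leibniz sign of the bracket is that of the derivative. *)
Lemma gen_deriv_mul g h w : gen_deriv g (gen h * w)
  = (g == h)%:R *: w + (-1) ^+ (vodd g && vodd h) *: (gen h * gen_deriv g w).
Proof.
rewrite /gen_deriv (bb_leibniz Hbr _ (gen_total_homog _)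
  (gen_total_homog _)) bracket_genE ksignE !odd_ideg vodd_conj.
rewrite scalerDr -scalerAl mul1r !scalerA mulrA deriv_sign_sqr mul1r.
by rewrite -scalerAr scalerA mulrC.
Qed.

(** The Koszul rule makes the square equal to its opposite, and 2 is nonzero by [natK]. *)
Lemma gen_sq g : vodd g -> gen g * gen g = 0.
Proof.
move=> og; have := gen_comm g g; rewrite og scaleN1r => E.
have : 2%:R *: (gen g * gen g) = 0.
  by rewrite scaler_nat mulr2n {2}E subrr.
by move/eqP; rewrite scaler_eq0 (negbTE (natK 1)) => /eqP.
Qed.

Lemma mon_elt_nonadmissible (m : mon n) : ~~ admissible m -> mon_elt m = 0.
Proof.
rewrite negb_forall => /existsP[g]; rewrite negb_imply -ltnNge => /andP[og mg].
rewrite mon_eltE.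
have -> : gen g ^+ m g = 0 -> \prod_h gen h ^+ m h = 0.
- move=> g0; have : g \in index_enum 'I_(n + n) by exact: mem_index_enum.
  elim: index_enum => // h s IH; rewrite inE big_cons => /orP[/eqP <-|/IH ->].
    by rewrite g0 mul0r.
  by rewrite mulr0.
- by [].
by rewrite -(subnKC mg) exprD expr2 gen_sq // mul0r.
Qed.

Lemma sum_delta (I : finType) (i : I) : (\sum_j (j == i))%N = 1%N.
Proof. by rewrite (bigD1 i) //= eqxx big1 // => j /negbTE ->. Qed.

Lemma enum_ord_pairwise N :
  pairwise (fun h k : 'I_N => h < k)%N (enum 'I_N).
Proof.
have := iota_ltn_sorted 0 N; rewrite -val_enum_ord.
by rewrite (sorted_pairwise ltn_trans) pairwise_map.
Qed.

Lemma big_enum_ord (R : Type) (idx : R) op N (F : 'I_N -> R) :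
  \big[op/idx]_i F i = \big[op/idx]_(i <- enum 'I_N) F i.
Proof. by rewrite [index_enum _]unlock -enumT. Qed.

(** A factor with exponent 0 is 1, so [g] can be deleted from the list of indices, and
    [deriv_ordprod0] applies to what is left. *)
Lemma gen_deriv_mon_elt0 g (m : mon n) : m g = 0%N -> gen_deriv g (mon_elt m) = 0.
Proof.
move=> mg; rewrite mon_eltE big_enum_ord.
have [s1 [s2 E]] : exists s1 s2, enum 'I_(n + n) = s1 ++ g :: s2.
  have : g \in enum 'I_(n + n) by rewrite mem_enum.
  by case/splitPr => s1 s2; exists s1, s2.
have := enum_uniq 'I_(n + n); rewrite E cat_uniq /= negb_or => /and4P[_ /andP[g1 _] g2 _].
rewrite big_cat big_cons /= mg mul1r -big_cat /=.
apply: (deriv_ordprod0 (gen_deriv1 g) (gen_deriv_mul g)).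
by rewrite mem_cat negb_or g1.
Qed.

Lemma gen_deriv_mon_elt g (m : mon n) : admissible (mon_incr g m) ->
  gen_deriv g (mon_elt (mon_incr g m))
  = ((-1) ^+ (vodd g * \sum_(h | vodd h && (h < g)) m h)%N * (m g).+1%:R)
      *: mon_elt m.
Proof.
move=> /forallP/(_ g)/implyP am; rewrite !mon_eltE.
rewrite [LHS](_ : _ = gen_deriv g (\prod_(h <- enum 'I_(n + n))
  gen h ^+ (m h + (h == g)))); last first.
  rewrite big_enum_ord; congr (gen_deriv g _).
  by apply: eq_bigr => h _; rewrite ffunE.
rewrite (deriv_ordprod (gen_deriv1 g) (gen_deriv_mul g)).
- by rewrite -[X in _ *: X]big_enum_ord big_enum_cond.
- exact: enum_ord_pairwise.
- by rewrite mem_enum.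
by move/am; rewrite ffunE eqxx addn1 ltnS leqn0 => /eqP.
Qed.

Lemma admissible_incr g (m : mon n) : admissible (mon_incr g m) -> admissible m.
Proof.
move=> /forallP h; apply/forallP => k; apply/implyP => /(implyP (h k)).
by rewrite ffunE; apply: leq_trans; apply: leq_addr.
Qed.

Lemma mon_decr (m : mon n) g : (0 < m g)%N ->
  m = mon_incr g [ffun h => m h - (h == g)]%N.
Proof.
by move=> mg; apply/ffunP => h; rewrite !ffunE subnK //; case: eqP => // ->.
Qed.

Lemma mon_incr_inj g : injective (@mon_incr n g).
Proof.
move=> m1 m2 /ffunP E; apply/ffunP => h; have := E h; rewrite !ffunE.
exact: addIn.
Qed.

(* Iterated derivatives followed by the augmentation separate the monomials,
   so the bracket itself shows that they are linearly independent. *)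
Lemma dual_functional (m : mon n) : admissible m ->
  exists f : W -> K, scalar f /\
    forall m', admissible m' -> f (mon_elt m') = (m' == m)%:R.
Proof.
have [N] := ubnP (\sum_g m g)%N; elim: N m => // N IH m mN am.
have [g mg|m0] := pickP (fun g => 0 < m g)%N; last first.
  have {m0} m0 : m = mon0.
    by apply/ffunP => g; rewrite ffunE; apply/eqP; rewrite -leqn0 leqNgt m0.
  (* The augmentation serves for the empty monomial: any other monomial contains a generator, which
     it kills. *)
  exists (@waug K V gr); split; first exact: waug_scalar.
  move=> m' _; rewrite m0; case: eqP => [->|/eqP m'0].
    by rewrite mon_elt0 waug1.
  rewrite mon_eltE; have [g m'g|m''0] := pickP (fun g => 0 < m' g)%N; last first.
    case/eqP: m'0; apply/ffunP => g; rewrite ffunE; apply/eqP.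
    by rewrite -leqn0 leqNgt m''0.
  have : g \in index_enum 'I_(n + n) by exact: mem_index_enum.
  elim: index_enum => // h s IHs; rewrite inE big_cons waugM.
  move=> /orP[/eqP <-|/IHs ->]; last by rewrite mulr0.
  by rewrite -(prednK m'g) exprS waugM waug_winj !mul0r.
have Em := mon_decr mg; set m1 := [ffun h => _] in Em.
have am1 : admissible m1 by apply: (@admissible_incr g); rewrite -Em.
have [|f [lf hf]] := IH m1 _ am1.
  suff <- : (\sum_h m h = (\sum_h m1 h).+1)%N by [].
  rewrite -addn1 -(sum_delta g) -big_split; apply: eq_bigr => h _.
  by rewrite {1}Em ffunE.
(* The coefficient that appears when [z^g] is differentiated out of [mon_incr g m']. Dividing by
   [c m1], nonzero by [natK], normalises the functional inherited from [m1]. *)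
pose c m' : K := (-1) ^+ (vodd g * \sum_(h | vodd h && (h < g)) m' h)%N * (m' g).+1%:R.
exists (fun w => (c m1)^-1 * f (gen_deriv g w)); split.
  move=> d x y; rewrite gen_deriv_linear lf mulrDr mulrCA //.
have f0 : f 0 = 0.
  by have := lf (-1) 0 0; rewrite scaler0 addr0 mulN1r addNr.
have fZ d x : f (d *: x) = d * f x by rewrite -[_ *: _]addr0 lf f0 addr0.
move=> m' am'; case: (posnP (m' g)) => m'g.
  rewrite gen_deriv_mon_elt0 // f0 mulr0; case: eqP => // E.
  by rewrite -E m'g in mg.
have Em' := mon_decr m'g; set m2 := [ffun h => _] in Em'.
rewrite [in LHS]Em' gen_deriv_mon_elt -?Em' // fZ -/(c m2).
rewrite hf; last by apply: (@admissible_incr g); rewrite -Em'.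
rewrite Em' [in RHS]Em (inj_eq (@mon_incr_inj g)).
case: eqP => [->|_]; last by rewrite !mulr0.
by rewrite mulr1 mulVf // /c mulf_neq0 ?natK // signr_eq0.
Qed.

(* The chain rule: both sides are derivations in [b] that agree on generators. *)
Lemma bracket_chain d x (m : mon n) : total_homog d x ->
  br x (mon_elt m) = \sum_g br x (gen g) * gen_deriv g (mon_elt m).
Proof.
move=> hx; pose P w := br x w = \sum_g br x (gen g) * gen_deriv g w.
have P1 : P 1.
  rewrite /P (bracket_1r hx) big1 // => g _.
  by rewrite gen_deriv1 mulr0.
have Pgen h w : P w -> P (gen h * w).
  rewrite /P (bb_leibniz Hbr w hx (gen_total_homog h)) => ->.
  under [RHS]eq_bigr => g _ do rewrite gen_deriv_mul mulrDr.
  rewrite big_split /=; congr (_ + _).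
    rewrite (bigD1 h) //= eqxx scale1r big1 ?addr0 // => g /negbTE ->.
    by rewrite scale0r mulr0.
  rewrite mulr_sumr scaler_sumr; apply: eq_bigr => g _.
  have hxg := bb_deg Hbr hx (gen_total_homog g).
  move: (gen_deriv g w) => u.
  (* Moving [z^h] across [[x, z^g]] costs [|h| (|x| + |g|)]; together with the Leibniz sign
     [|x| |h|] only [|g| |h|] remains, the sign in [gen_deriv_mul]. *)
  rewrite mulrA (total_homog_skew (gen_total_homog h) hxg).
  rewrite -scalerAl scalerA -scalerAr -[in LHS]mulrA; congr (_ *: (_ * _)).
  rewrite /ksign (odd_abszD d) !odd_ideg; case: (odd (absz d)); case: vodd;
    by case: vodd; rewrite /= ?mulN1r ?mulr1 ?mul1r ?opprK.
rewrite -/(P _) mon_eltE; elim: index_enum => [|g s IH]; first by rewrite big_nil.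
rewrite big_cons; elim: (m g) => [|k IHk]; first by rewrite mul1r.
by rewrite exprS -mulrA; apply: Pgen.
Qed.

(** * Monomials and symbols *)

(** Basis-adapted counterpart of [is_prod]. Admissibility is included because the coefficient
    functionals are known on admissible monomials. *)
Definition mon_class (p q : nat) (d : int) (w : W) : Prop :=
  exists m : mon n, [/\ admissible m, xdeg m = p, xideg m = q,
    mon_total_degree a m = d & w = mon_elt m].

Definition is_mon (w : W) : Prop := exists2 m, admissible m & w = mon_elt m.

Lemma mon_class_is_mon p q d w : spanned (mon_class p q d) w -> spanned is_mon w.
Proof.
by apply: spanned_sub => y [m [am _ _ _ ->]]; apply: spanned_gen; exists m.
Qed.

Lemma mon_class_mul p q d p' q' d' x y :
  spanned (mon_class p q d) x -> spanned (mon_class p' q' d') y ->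
  spanned (mon_class (p + p') (q + q') (d + d' + 2)) (x * y).
Proof.
apply: spanned_mul => u v [m [am <- <- <- ->]] [m' [am' <- <- <- ->]].
rewrite mon_elt_mul; apply: spannedZ.
case: (boolP (admissible (mon_add m m'))) => [am2|/mon_elt_nonadmissible ->].
  apply: spanned_gen; exists (mon_add m m').
  by rewrite xdeg_add xideg_add mon_total_degree_add.
exact: spanned0.
Qed.

Lemma xdeg_xvar i (m : mon n) : xdeg (mon_incr (xvar i) m) = (xdeg m).+1.
Proof.
rewrite /xdeg (eq_bigr (fun j => m (xvar j) + (j == i)))%N; last first.
  by move=> j _; rewrite ffunE eq_lshift.
by rewrite big_split /= sum_delta addn1.
Qed.

Lemma xideg_xvar i (m : mon n) : xideg (mon_incr (xvar i) m) = xideg m.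
Proof. by apply: eq_bigr => j _; rewrite ffunE eq_rlshift addn0. Qed.

Lemma xdeg_xivar i (m : mon n) : xdeg (mon_incr (xivar i) m) = xdeg m.
Proof. by apply: eq_bigr => j _; rewrite ffunE eq_lrshift addn0. Qed.

Lemma xideg_xivar i (m : mon n) : xideg (mon_incr (xivar i) m) = (xideg m).+1.
Proof.
rewrite /xideg (eq_bigr (fun j => m (xivar j) + (j == i)))%N; last first.
  by move=> j _; rewrite ffunE eq_rshift.
by rewrite big_split /= sum_delta addn1.
Qed.

Lemma xdeg0 : xdeg mon0 = 0%N :> nat.
Proof. by rewrite /xdeg big1 // => i _; rewrite ffunE. Qed.

Lemma xideg0 : xideg mon0 = 0%N :> nat.
Proof. by rewrite /xideg big1 // => i _; rewrite ffunE. Qed.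

Lemma admissible0 : admissible mon0.
Proof. by apply/forallP => g; apply/implyP; rewrite ffunE. Qed.

Lemma gen_mon g :
  admissible (mon_incr g mon0) /\
  \sum_h ideg a h *+ mon_incr g mon0 h = ideg a g.
Proof.
split.
  by apply/forallP => h; apply/implyP => _; rewrite !ffunE; case: eqP.
rewrite (bigD1 g) //= !ffunE eqxx big1 ?addr0 // => h /negbTE hg.
by rewrite !ffunE hg.
Qed.

Lemma gen_xvar_class i : mon_class 1 0 (- a i - 1) (gen (xvar i)).
Proof.
have [h1 h2] := gen_mon (xvar i); exists (mon_incr (xvar i) mon0).
rewrite /mon_total_degree h2 xdeg_xvar xideg_xvar xdeg0 xideg0 mon_elt_gen.
by split=> //; rewrite /ideg splitE.
Qed.

Lemma gen_xivar_class i : mon_class 0 1 (a i - 1) (gen (xivar i)).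
Proof.
have [h1 h2] := gen_mon (xivar i); exists (mon_incr (xivar i) mon0).
rewrite /mon_total_degree h2 xdeg_xivar xideg_xivar xdeg0 xideg0 mon_elt_gen.
by split=> //; rewrite /ideg splitE.
Qed.

Lemma in_dual_class d (f : dual_space V) : dual_homog gr d f ->
  spanned (mon_class 1 0 (d - 1)) (winj gr (in_dual f)).
Proof.
move=> hf.
have -> : in_dual f = \sum_i f (tnth e i) *: in_dual (dual_coord e i).
  rewrite {1}[f]dual_expand; elim/big_rec2: _ => // i u v _ <-.
  by rewrite /in_dual; congr (_, _); rewrite /= ?scaler0 ?addr0.
rewrite linear_sum; apply: spanned_sum => i; rewrite linearZ /=.
have [->|fi] := eqVneq (f (tnth e i)) 0; first by rewrite scale0r; apply: spanned0.
(* A form of degree [d] vanishes on basis vectors of degree other than [-d], so only coordinates of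
   degree [d] occur in it. *)
have ai : a i = - d.
  by apply/eqP; apply: contraNT fi => /hf/(_ (Ha i)) ->.
apply/spannedZ/spanned_gen; have := gen_xvar_class i.
by rewrite ai opprK /gen /gen_double splitE.
Qed.

Lemma in_vect_class d v : v \in gr d ->
  spanned (mon_class 0 1 (d - 1)) (winj gr (in_vect v)).
Proof.
move=> hv.
have -> : in_vect v = \sum_i coord e i v *: in_vect (tnth e i).
  rewrite {1}[v]coord_expand; elim/big_rec2: _ => // i u w _ <-.
  by rewrite /in_vect; congr (_, _); rewrite /= ?scaler0 ?addr0.
rewrite linear_sum; apply: spanned_sum => i; rewrite linearZ /=.
have [->|vi] := eqVneq (coord e i v) 0; first by rewrite scale0r; apply: spanned0.
have <- := coord_homog hv vi.
apply/spannedZ/spanned_gen; have := gen_xivar_class i.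
by rewrite /gen /gen_double splitE.
Qed.

(** Multiplication adds the total degrees and 2, so a factor of total degree [d i - 1] contributes
    [d i + 1]; the remaining [-2] is that of the empty product. *)
Lemma mon_class_prod (I : Type) (s : seq I) (p q : nat) (d : I -> int)
    (F : I -> W) :
  (forall i, spanned (mon_class p q (d i - 1)) (F i)) ->
  spanned (mon_class (size s * p) (size s * q)
             (\sum_(i <- s) d i + (size s)%:Z - 2))
    (\prod_(i <- s) F i).
Proof.
move=> hF; elim: s => [|i s IH].
  rewrite !big_nil; apply: spanned_gen; exists mon0.
  rewrite admissible0 xdeg0 xideg0 mon_elt0 /mon_total_degree xdeg0 xideg0.
  by split=> //; rewrite big1 // => g _; rewrite ffunE.
rewrite !big_cons /= !mulSn.
have := mon_class_mul (hF i) IH; congr (spanned (mon_class _ _ _) _).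
rewrite -(addn1 (size s)) PoszD; ring.
Qed.

Lemma bipart_class p q d w : bipart p q d w -> spanned (mon_class p q d) w.
Proof.
move/lspan_spanned; apply: spanned_sub => y [f [v [df [dv [hf hv -> ->]]]]].
have h1 := mon_class_prod (index_enum 'I_p) (fun i => in_dual_class (hf i)).
have h2 := mon_class_prod (index_enum 'I_q) (fun i => in_vect_class (hv i)).
have size_ord N : size (index_enum 'I_N) = N.
  by rewrite [index_enum _]unlock -enumT size_enum_ord.
have := mon_class_mul h1 h2; rewrite !size_ord !muln0 !muln1 addn0 add0n.
congr (spanned (mon_class _ _ _) _); rewrite PoszD; ring.
Qed.

(** A choice among the functionals of [dual_functional]. The value 0 at exponents that are not
    admissible agrees with the convention of [is_symbol]. *)
Definition mon_coef (m : mon n) : W -> K :=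
  match pselect (admissible m) with
  | left am => projT1 (cid (dual_functional am))
  | right _ => fun _ => 0
  end.

Lemma mon_coef_scalar m : scalar (mon_coef m).
Proof.
rewrite /mon_coef; case: pselect => [am|_]; last first.
  by move=> c x y; rewrite mulr0 addr0.
by case: cid => f [].
Qed.

HB.instance Definition _ m :=
  GRing.isLinear.Build K W K *%R (mon_coef m) (mon_coef_scalar m).

Lemma mon_coef_mon m m' : admissible m' -> mon_coef m (mon_elt m') = (m' == m)%:R.
Proof.
move=> am'; rewrite /mon_coef; case: pselect => [am|am].
  by case: cid => f [_ hf] /=; apply: hf.
by case: eqP => // E; rewrite -E in am.
Qed.

(** * The symbol map and its compatibility with products and derivatives *)

Definition symbol (w : W) : series K n := fun m => mon_coef m w.

Lemma symbol0 : symbol 0 = fun _ => 0.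
Proof. by apply: funext => m; apply: linear0. Qed.

Lemma symbol_lin c x y : symbol (c *: x + y) = fun m => c * symbol x m + symbol y m.
Proof. by apply: funext => m; apply: linearP. Qed.

Lemma smul_linl c (E E' F : series K n) m :
  smul a (fun m => c * E m + E' m) F m = c * smul a E F m + smul a E' F m.
Proof.
rewrite /smul; case: ifP => _; last by rewrite mulr0 addr0.
rewrite mulr_sumr -big_split; apply: eq_bigr => mu _ /=; ring.
Qed.

Lemma smul_linr c (E F F' : series K n) m :
  smul a E (fun m => c * F m + F' m) m = c * smul a E F m + smul a E F' m.
Proof.
rewrite /smul; case: ifP => _; last by rewrite mulr0 addr0.
rewrite mulr_sumr -big_split; apply: eq_bigr => mu _ /=; ring.
Qed.

Lemma smul0l (F : series K n) m : smul a (fun _ => 0) F m = 0.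
Proof.
by rewrite /smul; case: ifP => // _; rewrite big1 // => mu _; rewrite mulr0 mul0r.
Qed.

Lemma smul0r (E : series K n) m : smul a E (fun _ => 0) m = 0.
Proof. by rewrite /smul; case: ifP => // _; rewrite big1 // => mu _; rewrite mulr0. Qed.

Lemma mon_of_inj N : injective (@mon_of n N).
Proof.
move=> mu nu /ffunP E; apply/ffunP => g; apply: val_inj.
by have := E g; rewrite !ffunE.
Qed.

Lemma mon_of_surj N (m : mon n) : (forall g, m g <= N)%N ->
  exists mu : {ffun 'I_(n + n) -> 'I_N.+1}, mon_of mu = m.
Proof.
move=> mN; exists [ffun g => inord (m g)].
by apply/ffunP => g; rewrite !ffunE inordK ?ltnS.
Qed.

(** Both sides are supported at [mon_add m1 m2]: in the sum defining [smul] only the splitting with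
    first part [m1] survives. If that exponent is not admissible, the product vanishes in the
    algebra and [smul] vanishes by its truncation. *)
Lemma symbol_mul_mon m1 m2 m : admissible m1 -> admissible m2 ->
  symbol (mon_elt m1 * mon_elt m2) m
  = smul a (symbol (mon_elt m1)) (symbol (mon_elt m2)) m.
Proof.
move=> am1 am2; rewrite mon_elt_mul /symbol linearZ /= /smul.
have -> : mon_coef m (mon_elt (mon_add m1 m2))
    = if admissible m then (mon_add m1 m2 == m)%:R else 0.
  case: (boolP (admissible (mon_add m1 m2))) => am.
    rewrite mon_coef_mon //; case: eqP => [<-|_]; first by rewrite am.
    by rewrite if_same.
  rewrite mon_elt_nonadmissible // linear0; case: eqP => [<-|_]; last by rewrite if_same.
  by rewrite (negbTE am).
case: ifP => _; last by rewrite mulr0.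
rewrite [RHS](eq_bigr (fun mu => mon_sign K a (mon_of mu) (mon_sub m (mon_of mu))
  * (m1 == mon_of mu)%:R * (m2 == mon_sub m (mon_of mu))%:R)); last first.
  by move=> mu _; rewrite !mon_coef_mon.
case: eqP => [Em|nm].
  have mg g : (m1 g <= m g)%N by rewrite -Em ffunE leq_addr.
  have [mu Emu] : exists mu : {ffun 'I_(n + n) -> 'I_(\sum_g m g).+1}, mon_of mu = m1.
    apply: mon_of_surj => g; apply: leq_trans (mg g) _.
    by rewrite (bigD1 g) //= leq_addr.
  have subm : mon_sub m m1 = m2.
    by apply/ffunP => g; rewrite -Em !ffunE addKn.
  rewrite (bigD1 mu) /=; last by apply/forallP => g; have := mg g; rewrite -Emu ffunE.
  rewrite Emu subm !eqxx !mulr1 big1 ?addr0 // => nu /andP[_ nmu].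
  case: eqP => [E|_]; last by rewrite mulr0 mul0r.
  by rewrite -Emu in E; rewrite (mon_of_inj E) eqxx in nmu.
rewrite mulr0 big1 // => mu /forallP le_mu.
case: eqP => [E1|_]; last by rewrite mulr0 mul0r.
case: eqP => [E2|_]; last by rewrite mulr0.
case: nm; apply/ffunP => g; by rewrite ffunE E1 E2 !ffunE subnKC ?le_mu.
Qed.

Lemma symbol_mul x y m : spanned is_mon x -> spanned is_mon y ->
  symbol (x * y) m = smul a (symbol x) (symbol y) m.
Proof.
move=> hx hy; elim: hx => [|c u v [m1 am1 ->] _ IH].
  by rewrite mul0r symbol0 smul0l.
rewrite mulrDl -scalerAl !symbol_lin smul_linl IH; congr (_ * _ + _).
elim: hy {IH} => [|d u' v' [m2 am2 ->] _ IH]; first by rewrite mulr0 symbol0 smul0r.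
by rewrite mulrDr -scalerAr !symbol_lin smul_linr IH symbol_mul_mon.
Qed.

Lemma symbol_deriv_mon g m m' : admissible m' ->
  symbol (gen_deriv g (mon_elt m')) m = lderiv a g (symbol (mon_elt m')) m.
Proof.
move=> am'; rewrite /symbol /lderiv mon_coef_mon //.
case: (posnP (m' g)) => m'g.
  rewrite gen_deriv_mon_elt0 // linear0; case: eqP => [E|_]; last by rewrite mulr0.
  by move: m'g; rewrite E ffunE eqxx addn1.
have Em' := mon_decr m'g; set m2 := [ffun h => _] in Em'.
have am2 : admissible m2 by apply: (@admissible_incr g); rewrite -Em'.
rewrite Em' gen_deriv_mon_elt -?Em' // linearZ /= mon_coef_mon // Em'.
rewrite (inj_eq (@mon_incr_inj g)).
by case: eqP => [->|_]; rewrite // !mulr0.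
Qed.

Lemma symbol_deriv g x m : spanned is_mon x ->
  symbol (gen_deriv g x) m = lderiv a g (symbol x) m.
Proof.
have D0 : gen_deriv g 0 = 0 by rewrite /gen_deriv bracket0r scaler0.
elim=> [|c u v [m1 am1 ->] _ IH].
  by rewrite D0 !symbol0 /lderiv mulr0.
rewrite gen_deriv_linear !symbol_lin IH symbol_deriv_mon // /lderiv; ring.
Qed.

Lemma deriv_is_mon g x : spanned is_mon x -> spanned is_mon (gen_deriv g x).
Proof.
have D0 : gen_deriv g 0 = 0 by rewrite /gen_deriv bracket0r scaler0.
elim=> [|c u v [m1 am1 ->] _ IH]; first by rewrite D0; apply: spanned0.
rewrite gen_deriv_linear; apply: spanned_lin => //.
case: (posnP (m1 g)) => mg; first by rewrite gen_deriv_mon_elt0 //; apply: spanned0.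
have Em := mon_decr mg; set m2 := [ffun h => _] in Em.
rewrite Em gen_deriv_mon_elt -?Em //; apply/spannedZ/spanned_gen.
by exists m2 => //; apply: (@admissible_incr g); rewrite -Em.
Qed.

(** * The bracket of elements of total degree 1 in coordinates *)

Lemma odd_bracket_xivar x i : total_homog 1 x ->
  br x (gen (xivar i)) = gen_deriv (xvar i) x.
Proof.
move=> hx; rewrite (bb_antisym Hbr hx (gen_total_homog (xivar i))).
rewrite /gen_deriv /deriv_sign /conj_var splitE scaleNr; congr (- (_ *: _)).
have <- : vodd (xivar i) = vodd (xvar i).
  by rewrite -(vodd_conj (xvar i)) /conj_var splitE.
by rewrite /ksign odd_ideg.
Qed.

(** For [xivar] the antisymmetry sign is absorbed by [deriv_sign]; here it is left over,
    [deriv_sign] being 1 on the [xi] variables. *)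
Lemma odd_bracket_xvar x i : total_homog 1 x ->
  br x (gen (xvar i)) = - (-1) ^+ vodd (xvar i) *: gen_deriv (xivar i) x.
Proof.
move=> hx; rewrite (bb_antisym Hbr hx (gen_total_homog (xvar i))).
rewrite /gen_deriv /deriv_sign /conj_var splitE scale1r scaleNr.
by rewrite /ksign odd_ideg.
Qed.

Lemma odd_bracketE x y :
  total_homog 1 x -> total_homog 1 y -> spanned is_mon y ->
  br x y = \sum_i (gen_deriv (xvar i) x * gen_deriv (xivar i) y +
                   gen_deriv (xvar i) y * gen_deriv (xivar i) x).
Proof.
move=> hx hy sy.
have -> : br x y = \sum_g br x (gen g) * gen_deriv g y.
  elim: sy => [|c u v [m am ->] _ IH].
    rewrite bracket0r big1 // => g _.
    by rewrite /gen_deriv bracket0r scaler0 mulr0.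
  rewrite (bb_linr Hbr) IH (bracket_chain _ hx) scaler_sumr -big_split.
  apply: eq_bigr => g _ /=.
  by rewrite gen_deriv_linear mulrDr scalerAr.
rewrite big_split_ord /= addrC -big_split; apply: eq_bigr => i _ /=.
rewrite -/(xvar i) -/(xivar i) odd_bracket_xivar // odd_bracket_xvar //.
congr (_ + _).
have h1 : total_homog (ideg a (xvar i) - 1 + 1) (gen_deriv (xivar i) x).
  rewrite /gen_deriv /conj_var splitE; apply: total_homogZ.
  exact: (bb_deg Hbr (gen_total_homog (xvar i)) hx).
have h2 : total_homog (ideg a (xivar i) - 1 + 1) (gen_deriv (xvar i) y).
  rewrite /gen_deriv /conj_var splitE; apply: total_homogZ.
  exact: (bb_deg Hbr (gen_total_homog (xivar i)) hy).
move: h1 h2; move: (gen_deriv _ _) (gen_deriv _ _) => u v h1 h2.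
(* Both factors have parity [1 + vodd], so exchanging them gives [- (-1) ^+ vodd], which cancels the
   sign left by [odd_bracket_xvar]. *)
rewrite -scalerAl (total_homog_skew h1 h2) scalerA.
rewrite /ksign !(odd_abszD _ 1) !odd_ideg.
have -> : vodd (xivar i) = vodd (xvar i).
  by rewrite -(vodd_conj (xvar i)) /conj_var splitE.
by case: vodd; rewrite /= ?mulr1 ?opprK ?mulN1r ?opprK scale1r.
Qed.

Lemma mon_coef_class p q d w m : spanned (mon_class p q d) w -> mon_coef m w != 0 ->
  [/\ admissible m, xdeg m = p, xideg m = q & mon_total_degree a m = d].
Proof.
elim=> [|c u v [m' [am xm xim dm ->]] _ IH]; first by rewrite linear0 eqxx.
rewrite linearP /= mon_coef_mon //; case: (m' =P m) => [<- _|_]; first by split.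
by rewrite mulr0 add0r.
Qed.

Lemma component_elt_lin k l c (E F : series K n) :
  component_elt gr e k l (fun m => c * E m + F m)
  = c *: component_elt gr e k l E + component_elt gr e k l F.
Proof.
rewrite /component_elt scaler_sumr -big_split; apply: eq_bigr => mu _ /=.
by rewrite scalerDl scalerA.
Qed.

Lemma leq_xdeg_xideg (m : mon n) g : (m g <= xdeg m + xideg m)%N.
Proof. by rewrite -sum_mon (bigD1 g) //= leq_addr. Qed.

Lemma component_elt_symbol k l d w : spanned (mon_class k l d) w ->
  component_elt gr e k l (symbol w) = w.
Proof.
elim=> [|c u v [m [am xm xim _ ->]] _ IH].
  by rewrite symbol0 /component_elt big1 // => mu _; rewrite scale0r.
rewrite symbol_lin component_elt_lin IH; congr (_ *: _ + _).
have [mu Emu] : exists mu : {ffun 'I_(n + n) -> 'I_(k + l).+1}, mon_of mu = m.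
  by apply: mon_of_surj => g; rewrite -xm -xim leq_xdeg_xideg.
rewrite /component_elt (bigD1 mu) /=; last by rewrite Emu xm xim !eqxx.
rewrite Emu /symbol mon_coef_mon // eqxx scale1r big1 ?addr0 // => nu /andP[_ nmu].
rewrite mon_coef_mon //; case: eqP => [E|_]; last by rewrite scale0r.
by rewrite -Emu in E; rewrite (mon_of_inj E) eqxx in nmu.
Qed.

(** Recovers a symbol from its components; uniqueness of the symbol rests on this. *)
Lemma mon_coef_component k l (E : series K n) m : is_symbol a E ->
  xdeg m = k -> xideg m = l -> mon_coef m (component_elt gr e k l E) = E m.
Proof.
move=> sE xm xim; rewrite /component_elt linear_sum /=.
have [mu Emu] : exists mu : {ffun 'I_(n + n) -> 'I_(k + l).+1}, mon_of mu = m.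
  by apply: mon_of_surj => g; rewrite -xm -xim leq_xdeg_xideg.
rewrite (bigD1 mu) /=; last by rewrite Emu xm xim !eqxx.
rewrite big1 ?addr0 => [|nu /andP[_ nmu]]; rewrite linearZ /= ?Emu.
  case: (boolP (admissible m)) => am; last by rewrite sE // mul0r.
  by rewrite mon_coef_mon // eqxx mulr1.
case: (boolP (admissible (mon_of nu))) => am; last by rewrite sE // mul0r.
rewrite mon_coef_mon //; case: eqP => [E1|_]; last by rewrite mulr0.
by rewrite -Emu in E1; rewrite (mon_of_inj E1) eqxx in nmu.
Qed.

(** The two signs count the odd variables after and before [g]. An odd [g] occurs exactly once in
    the odd monomial, so the others are even in number and the counts have the same parity; for even
    [g] there is no sign. *)
Lemma rderiv_odd g (E : series K n) m : is_symbol a E ->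
  (forall m', E m' != 0 -> mon_parity a m') ->
  rderiv a g E m = lderiv a g E m.
Proof.
move=> sE oE; rewrite /rderiv /lderiv.
have [->|Em] := eqVneq (E (mon_incr g m)) 0; first by rewrite !mulr0.
congr (_ * _ * _); case: (boolP (vodd g)) => og; last by rewrite !mul0n.
rewrite !mul1n -signr_odd -[RHS]signr_odd; congr ((-1) ^+ nat_of_bool _).
have mg : m g = 0%N.
  have am : admissible (mon_incr g m) by apply: contraNT Em => /sE ->.
  move/forallP/(_ g): am; rewrite og ffunE eqxx addn1 ltnS leqn0.
  by move/eqP.
have := oE _ Em; rewrite /mon_parity (bigD1 g) //= ffunE eqxx mg.
rewrite (bigID (fun h : 'I_(n + n) => h < g)%N) /= !oddD.
have -> : (\sum_(h | vodd h && (h != g) && (h < g)%N) mon_incr g m h)%N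
    = (\sum_(h | vodd h && (h < g)%N) m h)%N.
  apply: eq_big => [h|h /andP[/andP[_ hg] _]]; last by rewrite ffunE (negbTE hg) addn0.
  by rewrite -andbA; case: (ltnP h g) => hg; rewrite ?andbF // -val_eqE neq_ltn hg.
have -> : (\sum_(h | vodd h && (h != g) && ~~ (h < g)%N) mon_incr g m h)%N
    = (\sum_(h | vodd h && (g < h)%N) m h)%N.
  apply: eq_big => [h|h /andP[/andP[_ hg] _]]; last by rewrite ffunE (negbTE hg) addn0.
  by rewrite -andbA -leqNgt -val_eqE /= eq_sym -ltn_neqAle.
by rewrite addFb; case: (odd _); case: (odd _).
Qed.

(** * The symbol of a structure [T] *)

Section Structure.
Variable T : nat -> nat -> W.
Hypothesis HT : is_Linfty_bialgebra br T.

(** The exponent [m] fixes the only bidegree in which it can occur, so each coefficient of the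
    formal sum is read off from a single component. *)
Definition structure_symbol : series K n :=
  fun m => mon_coef m (T (xdeg m) (xideg m)).
Local Notation Q := structure_symbol.

Lemma structure_class k l : spanned (mon_class k l 1) (T k l).
Proof. exact/bipart_class/(lb_deg HT). Qed.

Lemma structure_is_mon k l : spanned is_mon (T k l).
Proof. exact/mon_class_is_mon/structure_class. Qed.

Lemma structure_homog k l : total_homog 1 (T k l).
Proof. exact/bipart_total_homog/(lb_deg HT). Qed.

Lemma symbol_structure k l m :
  symbol (T k l) m = if (xdeg m == k) && (xideg m == l) then Q m else 0.
Proof.
case: ifP => [/andP[/eqP <- /eqP <-] //|ne].
apply/eqP; apply: contraFT ne => /(mon_coef_class (structure_class k l)).
by case=> _ -> -> _; rewrite !eqxx.
Qed.

Lemma structure_symbol_neq0 m : Q m != 0 ->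
  [/\ admissible m, T (xdeg m) (xideg m) != 0 & mon_total_degree a m = 1].
Proof.
move=> Qm; have [am _ _ dm] := mon_coef_class (structure_class _ _) Qm.
by split=> //; apply: contraNneq Qm => E; rewrite /Q E linear0.
Qed.

Lemma is_symbol_structure : is_symbol a Q.
Proof.
move=> m nam; apply/eqP; apply: contraNT nam.
by case/structure_symbol_neq0.
Qed.

Lemma structure_odd m : Q m != 0 -> mon_parity a m.
Proof. by case/structure_symbol_neq0 => _ _ E; rewrite mon_parityE E. Qed.

Lemma component_structure k l : component_elt gr e k l Q = T k l.
Proof.
rewrite -[RHS](component_elt_symbol (structure_class k l)).
by apply: eq_bigr => mu h; rewrite symbol_structure h.
Qed.

(** [dg] and [dh] are the bidegrees of the two variables, with sum (1, 1), the bidegree removed by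
    the bracket. For a splitting [m = m1 + m2] only one pair [(k, l)] contributes, namely the
    bidegree of [m1] plus [dg], so the double sum collapses to a product of series. *)
Lemma smul_deriv_structure g h m (dg dh : nat * nat) :
    (forall m', xdeg (mon_incr g m') = xdeg m' + dg.1 /\
                xideg (mon_incr g m') = xideg m' + dg.2)%N ->
    (forall m', xdeg (mon_incr h m') = xdeg m' + dh.1 /\
                xideg (mon_incr h m') = xideg m' + dh.2)%N ->
    (dg.1 + dh.1 = 1)%N -> (dg.2 + dh.2 = 1)%N ->
  \sum_(k < (xdeg m).+2) \sum_(l < (xideg m).+2)
    symbol (gen_deriv g (T k l) *
            gen_deriv h (T ((xdeg m).+1 - k)%N ((xideg m).+1 - l)%N)) m
  = smul a (lderiv a g Q) (lderiv a h Q) m.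
Proof.
move=> Hg Hh dg1 dg2.
under eq_bigr => k _ do under eq_bigr => l _ do
  rewrite (symbol_mul _ (deriv_is_mon _ (structure_is_mon _ _))
                        (deriv_is_mon _ (structure_is_mon _ _))).
rewrite /smul; case: ifP => am; last by rewrite big1 // => k _; rewrite big1.
under eq_bigr => k _ do rewrite exchange_big /=.
rewrite exchange_big /=; apply: eq_bigr => mu /forallP le_mu.
set m1 := mon_of mu; set m2 := mon_sub m m1.
have Em : m = mon_add m1 m2.
  by apply/ffunP => i; rewrite !ffunE subnKC.
have xm : xdeg m = (xdeg m1 + xdeg m2)%N by rewrite {1}Em xdeg_add.
have xim : xideg m = (xideg m1 + xideg m2)%N by rewrite {1}Em xideg_add.
have [x1 xi1] := Hg m1; have [x2 xi2] := Hh m2.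
(* Before differentiation the degree can exceed that of [m] by one, which the bounds [.+2] allow. *)
have lt_k : (xdeg m1 + dg.1 < (xdeg m).+2)%N by lia.
have lt_l : (xideg m1 + dg.2 < (xideg m).+2)%N by lia.
rewrite (bigD1 (Ordinal lt_k)) //= [X in _ + X]big1 ?addr0; last first.
  move=> k nk; rewrite big1 // => l _.
  rewrite (symbol_deriv _ _ (structure_is_mon _ _)) /lderiv symbol_structure x1.
  case: eqP => [E|_]; last by rewrite !(mulr0, mul0r).
  by case/eqP: nk; apply: val_inj.
rewrite (bigD1 (Ordinal lt_l)) //= [X in _ + X]big1 ?addr0; last first.
  move=> l nl.
  rewrite (symbol_deriv _ _ (structure_is_mon _ _)) /lderiv symbol_structure xi1.
  rewrite andbC; case: eqP => [E|_]; last by rewrite !(mulr0, mul0r).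
  by case/eqP: nl; apply: val_inj.
rewrite !(symbol_deriv _ _ (structure_is_mon _ _)) /lderiv !symbol_structure.
rewrite x1 xi1 x2 xi2 !eqxx /=.
have -> : (xdeg m2 + dh.1 == (xdeg m).+1 - (xdeg m1 + dg.1))%N by lia.
by have -> : (xideg m2 + dh.2 == (xideg m).+1 - (xideg m1 + dg.2))%N by lia.
Qed.

(** [odd_bracketE] writes the component of [[T, T]] in the bidegree of [m] as two families of terms
    with the same sum. Its coefficient at [m] is thus [S + S], and 2 is nonzero. *)
Lemma sum_smul_deriv m :
  \sum_i smul a (lderiv a (xvar i) Q) (lderiv a (xivar i) Q) m = 0.
Proof.
set S := \sum_i _.
have x_incr (i : 'I_n) m' : (xdeg (mon_incr (xvar i) m') = xdeg m' + (1, 0).1 /\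
                    xideg (mon_incr (xvar i) m') = xideg m' + (1, 0).2)%N.
  by rewrite xdeg_xvar xideg_xvar addn1 addn0.
have xi_incr (i : 'I_n) m' : (xdeg (mon_incr (xivar i) m') = xdeg m' + (0, 1).1 /\
                     xideg (mon_incr (xivar i) m') = xideg m' + (0, 1).2)%N.
  by rewrite xdeg_xivar xideg_xivar addn1 addn0.
pose B g h k l := symbol (gen_deriv g (T k l) *
            gen_deriv h (T ((xdeg m).+1 - k)%N ((xideg m).+1 - l)%N)) m.
have BS : \sum_(k < (xdeg m).+2) \sum_(l < (xideg m).+2)
    \sum_i B (xvar i) (xivar i) k l = S.
  under eq_bigr => k _ do rewrite exchange_big.
  rewrite exchange_big; apply: eq_bigr => i _.
  exact: (smul_deriv_structure _ (x_incr i) (xi_incr i)).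
have SS : S + S = 0.
  rewrite -[RHS](linear0 (mon_coef m)) -(lb_maurer_cartan HT (xdeg m) (xideg m)).
  rewrite /fbracket linear_sum /= -{1}BS.
  (* Reversing both indices exchanges the two arguments of the bracket, which matches the second
     family with the first. *)
  have -> : S = \sum_(k < (xdeg m).+2) \sum_(l < (xideg m).+2)
      \sum_i B (xvar i) (xivar i) ((xdeg m).+1 - k)%N ((xideg m).+1 - l)%N.
    rewrite -BS (reindex_inj rev_ord_inj) /=; apply: eq_bigr => k _.
    rewrite (reindex_inj rev_ord_inj) /=; apply: eq_bigr => l _.
    by rewrite !subSS.
  rewrite -big_split; apply: eq_bigr => k _ /=; rewrite linear_sum -big_split.
  apply: eq_bigr => l _ /=.
  rewrite odd_bracketE ?linear_sum; [|exact: structure_homog..|exact: structure_is_mon].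
  rewrite -big_split; apply: eq_bigr => i _; rewrite linearD /= /B /symbol.
  by rewrite !subKn // -ltnS ltn_ord.
apply/eqP; have : 2%:R * S = 0 by rewrite mulr_natl mulr2n.
by move/eqP; rewrite mulf_eq0 (negbTE (natK 1)).
Qed.

(** As [Q] is odd, only [p = q = true] survives, and its sign turns the difference into a sum of two
    copies of the expression in [sum_smul_deriv]. *)
Lemma poisson_structure m : poisson a Q Q m = 0.
Proof.
have partT : parity_part a true Q = Q.
  apply: funext => m'; rewrite /parity_part.
  by have [->|/structure_odd ->] := eqVneq (Q m') 0; rewrite ?if_same.
have partF : parity_part a false Q = fun _ => 0.
  apply: funext => m'; rewrite /parity_part.
  by have [->|/structure_odd ->] := eqVneq (Q m') 0; rewrite ?if_same.
have rl g : rderiv a g Q = lderiv a g Q.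
  by apply: funext => m'; apply: rderiv_odd;
    [exact: is_symbol_structure|exact: structure_odd].
have d0 g : lderiv a g (fun _ => 0 : K) = fun _ => 0.
  by apply: funext => m'; rewrite /lderiv mulr0.
have r0 g : rderiv a g (fun _ => 0 : K) = fun _ => 0.
  by apply: funext => m'; rewrite /rderiv mulr0.
rewrite /poisson; under eq_bigr => i _.
  rewrite !big_bool partT partF /= !d0 !r0 !smul0l !smul0r !mulr0 !addr0 rl.
  rewrite expr1 mulN1r opprK.
  over.
by rewrite big_split /= sum_smul_deriv addr0.
Qed.

Lemma symbol_existence_uniqueness :
  exists! E : series K n,
    [/\ is_symbol a E,
        (forall m, E m != 0 -> (1 <= xdeg m)%N /\ (1 <= xideg m)%N),
        (forall m, E m != 0 -> mon_total_degree a m = 1),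
        (forall k l, component_elt gr e k l E = T k l)
      & (forall m, poisson a E E m = 0)].
Proof.
exists Q; split.
  split; [exact: is_symbol_structure| | |exact: component_structure
         |exact: poisson_structure].
    move=> m /structure_symbol_neq0[_ Tm _]; rewrite !lt0n.
    by split; apply: contraNneq Tm => E; rewrite (lb_pos HT) // E ?eqxx ?orbT.
  by move=> m /structure_symbol_neq0[].
(* Uniqueness: the coefficient at [m] is determined by the component in the bidegree of [m]. *)
move=> E [sE _ _ cE _]; apply: funext => m.
by rewrite /Q -(cE (xdeg m)) mon_coef_component.
Qed.

End Structure.

End HomogeneousBasis.

(** * The real and complex ground fields, both of characteristic zero *)

Lemma ground_natr_neq0 (R : realType) (c : scalars) k :
  k.+1%:R != 0 :> ground R c.
Proof. by case: c; rewrite /= pnatr_eq0. Qed.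

Theorem proposition30 (R : realType) (c : scalars)
    (V : vectType (ground R c)) (gr : int -> {vspace V}) (Hgr : is_grading gr)
    (br : walg gr -> walg gr -> walg gr) (Hbr : is_big_bracket br)
    (n : nat) (e : n.-tuple V) (a : 'I_n -> int)
    (He : basis_of fullv e) (Ha : forall i, tnth e i \in gr (a i))
    (T : nat -> nat -> walg gr) (HT : is_Linfty_bialgebra br T) :
  exists! Q : series (ground R c) n,
    [/\ is_symbol a Q,
        (forall m, Q m != 0 -> (1 <= xdeg m)%N /\ (1 <= xideg m)%N),
        (forall m, Q m != 0 -> mon_total_degree a m = 1),
        (forall k l, component_elt gr e k l Q = T k l)
      & (forall m, poisson a Q Q m = 0)].
Proof.
exact: (symbol_existence_uniqueness Hgr He Ha Hbr (@ground_natr_neq0 R c) HT).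
Qed.
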